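(* Let $n\ge 3$. (a) Let $c_1,\dots,c_{2n-2}\in\mathbb{R}^n$ affinely span $\mathbb{R}^n$, and let $r_1,\dots,r_{2n-2}>0$. If the $2n-2$ spheres with centers $c_i$ and radii $r_i$ have only a finite number of complex common tangent lines, then that number is at most $3\cdot 2^{n-1}$. (b) There exists a configuration of $2n-2$ spheres in $\mathbb{R}^n$ having (exactly) $3\cdot 2^{n-1}$ different real common tangent lines. Moreover, such a configuration can be achieved with unit spheres, i.e. with all $2n-2$ radii equal to $1$.
   Context: For $x,y\in\mathbb{C}^n$ write $x\cdot y:=\sum_{i=1}^n x_iy_i$ (bilinear, no complex conjugation) and $x^2:=x\cdot x$. Spheres are not required to be disjoint. A (complex) line in $\mathbb{C}^n$ is given by a point $p\in\mathbb{C}^n$ on it and a direction $v\in\mathbb{C}^n\setminus\{0\}$. The line is tangent to the sphere with center $c\in\mathbb{R}^n$ and radius $r>0$ if it is tangent to the complex quadric hypersurface $(x-c)^2=r^2$, i.e. the quadratic equation $(p+tv-c)^2=r^2$ in $t$ has a solution of multiplicity two, expressed by the vanishing of its discriminant: $[v\cdot(p-c)]^2=v^2\,((p-c)^2-r^2)$. A complex common tangent line to a collection of spheres is a line in $\mathbb{C}^n$ tangent to each of them. A common tangent line is real if it is a line of $\mathbb{R}^n$ (i.e. $p$ and $v$ can be chosen real); for a real line, tangency to the sphere is equivalent to having Euclidean distance $r$ from $c$. *)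

(* Defs.v *)
From HB Require Import structures.
From mathcomp Require Import all_boot all_order all_algebra.
From mathcomp Require Import boolp classical_sets functions cardinality reals.
From mathcomp.real_closed Require Import complex.
From mathcomp Require Import ring.

Set Implicit Arguments.
Unset Strict Implicit.
Unset Printing Implicit Defensive.

Import Order.TTheory GRing.Theory Num.Theory.
Local Open Scope classical_set_scope.
Local Open Scope ring_scope.
Local Open Scope complex_scope.

(* The bilinear (not Hermitian) product, also over the complex numbers. *)
Definition dotp (K : comNzRingType) (n : nat) (x y : 'rV[K]_n) : K :=
  \sum_(i < n) x 0 i * y 0 i.

Definition complexify (R : realType) (n : nat) (x : 'rV[R]_n) : 'rV[R[i]]_n :=
  map_mx (real_complex R) x.

Definition cline (R : realType) (n : nat) (p v : 'rV[R[i]]_n) :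
    set 'rV[R[i]]_n :=
  [set p + t *: v | t in [set: R[i]]].

(* Vanishing of the discriminant of (p + t v - c)^2 = r^2 as a quadratic
   equation in t.  Isotropic directions (v^2 = 0) are allowed; the formula then
   says v . (p - c) = 0. *)
Definition tangent (R : realType) (n : nat) (p v : 'rV[R[i]]_n)
    (c : 'rV[R]_n) (r : R) : Prop :=
  let q := p - complexify c in
  dotp v q ^+ 2 = dotp v v * (dotp q q - r%:C ^+ 2).

(* Lines are counted as point sets, not as pairs (p, v).  By [tangent_cline]
   below, tangency does not depend on the chosen p and v. *)
Definition common_tangents (R : realType) (n m : nat)
    (c : 'I_m -> 'rV[R]_n) (r : 'I_m -> R) : set (set 'rV[R[i]]_n) :=
  [set L | exists p v : 'rV[R[i]]_n,
     [/\ v != 0, L = cline p v & forall i, tangent p v (c i) (r i)]].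

Definition real_line (R : realType) (n : nat) : set (set 'rV[R[i]]_n) :=
  [set L | exists p v : 'rV[R]_n,
     v != 0 /\ L = cline (complexify p) (complexify v)].

Definition real_common_tangents (R : realType) (n m : nat)
    (c : 'I_m -> 'rV[R]_n) (r : 'I_m -> R) : set (set 'rV[R[i]]_n) :=
  common_tangents c r `&` @real_line R n.

Definition affinely_spans (R : realType) (n m : nat) (c : 'I_m -> 'rV[R]_n) :
    Prop :=
  forall x : 'rV[R]_n, exists a : 'I_m -> R,
    \sum_(i < m) a i = 1 /\ x = \sum_(i < m) a i *: c i.

Lemma dotpC (K : comNzRingType) (n : nat) (x y : 'rV[K]_n) :
  dotp x y = dotp y x.
Proof. by apply: eq_bigr => i _; rewrite mulrC. Qed.

Lemma dotpDl (K : comNzRingType) (n : nat) (x y z : 'rV[K]_n) :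
  dotp (x + y) z = dotp x z + dotp y z.
Proof. by rewrite -big_split; apply: eq_bigr => i _; rewrite mxE mulrDl. Qed.

Lemma dotpZl (K : comNzRingType) (n : nat) (a : K) (x y : 'rV[K]_n) :
  dotp (a *: x) y = a * dotp x y.
Proof. by rewrite /dotp mulr_sumr; apply: eq_bigr => i _; rewrite mxE mulrA. Qed.

Lemma tangent_cline (R : realType) (n : nat) (p v p' v' : 'rV[R[i]]_n)
    (c : 'rV[R]_n) (r : R) :
  cline p v = cline p' v' -> tangent p v c r -> tangent p' v' c r.
Proof.
move=> E.
have /= [s _ Ep] : cline p v p' by rewrite E; exists 0; rewrite // scale0r addr0.
have /= [s' _ Ev] : cline p v (p' + v').
  by rewrite E; exists 1; rewrite // scale1r.
have {Ev}-> : v' = (s' - s) *: v.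
  by apply: (addrI p'); rewrite -Ev -Ep scalerBl addrA addrAC addrK.
rewrite -Ep /tangent /=.
have -> : p + s *: v - complexify c = (p - complexify c) + s *: v.
  by rewrite addrAC.
set q := p - _; set k := s' - s => T; clearbody q k.
have -> : dotp (k *: v) (q + s *: v) = k * (dotp v q + s * dotp v v).
  by rewrite dotpZl dotpC dotpDl dotpZl (dotpC q).
have -> : dotp (k *: v) (k *: v) = k * (k * dotp v v).
  by rewrite dotpZl dotpC dotpZl.
have -> : dotp (q + s *: v) (q + s *: v) =
    dotp q q + 2 * s * dotp v q + s ^+ 2 * dotp v v.
  rewrite dotpDl dotpZl (dotpC q (q + _)) (dotpC v (q + _)) !dotpDl !dotpZl.
  rewrite (dotpC q v).
  by ring.
have -> : (k * (dotp v q + s * dotp v v)) ^+ 2 =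
    k ^+ 2 * (dotp v q ^+ 2 + dotp v v * (2 * s * dotp v q + s ^+ 2 * dotp v v)).
  by ring.
by rewrite T; ring.
Qed.

(* Main.v *)
Require Import Defs.
From mathcomp Require Import all_boot all_order all_algebra.
From mathcomp Require Import boolp classical_sets functions cardinality reals.
From mathcomp.real_closed Require Import complex.
From mathcomp Require lebesgue_measure.
From mathcomp Require Import mpoly.
From mathcomp Require Import ring lra zify.

Set Implicit Arguments.
Unset Strict Implicit.
Unset Printing Implicit Defensive.

(** Upper bound.  Move one center c_0 to the origin, write d_i for the other
    translated centers, and describe a common tangent by its direction v and
    the foot q of the perpendicular from the origin, so q.v = 0 and
    q^2 = r_0^2.  As the centers span affinely, no tangent direction is
    isotropic ([tangent_nonisotropic]), and tangency to the i-th sphere becomes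
    2 v^2 (q.d_i) = Q_i(v) with Q_i a quadratic form ([tangent_quad]).  The
    equations of n independent d_i express v^2 q by quadratic forms in v;
    substituting leaves n - 3 quadrics, the cubic q.v = 0 and the quartic
    q^2 = r_0^2 in the homogeneous unknown v, and
    2^(n-3) * 3 * 4 = 3 * 2^(n-1).  A normalization l.v = 1, with l chosen
    nonzero on all the tangent directions, makes the system affine and square.

    The system can have spurious zeros, even infinitely many, on v^2 = 0.  What
    is needed is therefore Bezout's inequality for the zeros in the open set
    g <> 0 when only those are finite in number ([bezout_bound]).  It is proved
    by counting dimensions.  Let z_1, ..., z_N be these zeros of f_1, ..., f_n,
    and let the polynomial e_i vanish at z_j exactly when j <> i.  The products
    e_i f^a are linearly independent ([powers_independent]).  Those with
    sum_j a_j deg f_j < D have degree < D + E for a constant E, so N times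
    their number of exponents a is at most the number of monomials of degree
    < D + E, and for large D this forces N <= prod_j deg f_j.

    Independence is a local matter: the lowest part in a of a linear relation,
    looked at near some z_j, is a form of degree k in the f_i lying in M (f)^k,
    where M is the maximal ideal of z_j.  Such a form is zero
    ([fiber_cone_free]), since otherwise the number of generators of (f)^l
    grows like l^(n-2), and the dimension of the polynomials modulo M^L like
    L^(n-1) instead of L^n.  This uses that a power of M lies in (f) locally,
    which the Nullstellensatz provides at an isolated zero ([isolated_at0]).
    The proof of the Nullstellensatz is the short one that works over an
    uncountable field.

    Configuration.  In coordinates 1, 2, 3 put the regular tetrahedron with
    vertices s (+-1, +-1, +-1), product of signs +1, and for every other
    coordinate j the two points +- sqrt 3 s e_j.  For a line through p with
    direction v, p.v = 0 and v^2 = n, the pair for j gives p_j = 0 and a common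
    value of the v_j^2; the tetrahedron gives n p_1 = - s v_2 v_3 and its cyclic
    variants, so p.v = 0 turns into v_1 v_2 v_3 = 0: the cubic splits.  With
    s = n / sqrt (3 n^2 - 3 n + 2) the remaining conditions are v_j^2 = 1 and
    {v_1^2, v_2^2, v_3^2} = {0, 1, 2} ([tangents_direction]).  There are six
    ways to place 0, 1, 2 and n - 1 signs, up to a global sign:
    6 * 2^(n-2) = 3 * 2^(n-1) lines, all real. *)

Import Order.TTheory GRing.Theory Num.Theory.
Local Open Scope ring_scope.

(** * Linear dependence and ideals *)

Lemma lin_dep (F : fieldType) (I J : finType) (B : {pred I}) (A : {pred J})
    (C : I -> J -> F) : (#|A| < #|B|)%N ->
  exists l : I -> F, [/\ exists i, l i != 0, forall i, i \notin B -> l i = 0 &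
    forall j, j \in A -> \sum_i l i * C i j = 0].
Proof.
move=> ltAB.
pose M := \matrix_(i < #|B|, j < #|A|) C (enum_val i) (enum_val j).
have /rowV0Pn[v /sub_kermxP vM0 /rV0Pn[i0 vi0]] : kermx M != 0.
  rewrite -mxrank_eq0 mxrank_ker subn_eq0 -ltnNge.
  exact: leq_ltn_trans (rank_leq_col M) ltAB.
have B0 : enum_val i0 \in B by exact: enum_valP.
pose l i := if i \in B then v 0 (enum_rank_in B0 i) else 0.
have lE i : l (enum_val i) = v 0 i by rewrite /l enum_valP enum_valK_in.
exists l; split=> [|i /negPf iB|j jA]; first by exists (enum_val i0); rewrite lE.
  by rewrite /l iB.
have /rowP/(_ (enum_rank_in jA j)) := vM0; rewrite !mxE => {2}<-.
rewrite (bigID (mem B)) /= [X in _ + X]big1 ?addr0; last first.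
  by move=> i /negPf iB; rewrite /l iB mul0r.
rewrite big_enum_val; apply: eq_bigr => i _.
by rewrite lE !mxE enum_rankK_in.
Qed.

Definition ideal (A : comNzRingType) (I : A -> Prop) :=
  I 0 /\ forall a x y, I x -> I y -> I (a * x + y).

Section Ideal.
Context (A : comNzRingType) (I : A -> Prop) (idI : ideal I).

Lemma idealD x y : I x -> I y -> I (x + y).
Proof. by move=> Ix Iy; rewrite -[x]mul1r; apply: idI.2. Qed.

Lemma idealMl a x : I x -> I (a * x).
Proof. by move=> Ix; rewrite -[_ * _]addr0; apply: idI.2 => //; exact: idI.1. Qed.

Lemma idealN x : I x -> I (- x).
Proof. by move=> Ix; rewrite -mulN1r; apply: idealMl. Qed.

Lemma idealB x y : I x -> I y -> I (x - y).
Proof. by move=> Ix Iy; apply: idealD => //; apply: idealN. Qed.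

Lemma ideal_sum (T : Type) (r : seq T) (P : pred T) (F : T -> A) :
  (forall i, P i -> I (F i)) -> I (\sum_(i <- r | P i) F i).
Proof. by move=> IF; apply: big_ind => //; [exact: idI.1 | exact: idealD]. Qed.

Lemma ideal_adjoin g : ideal (fun x => exists u q, I u /\ x = u + q * g).
Proof.
split; first by exists 0, 0; split; [exact: idI.1 | rewrite mul0r addr0].
move=> a x y [u [q [Iu ->]]] [u' [q' [Iu' ->]]].
exists (a * u + u'), (a * q + q'); split; first exact: idI.2.
by ring.
Qed.

End Ideal.

(** * Nullstellensatz over an uncountable field *)

(** Pigeonhole form of uncountability: a map to the natural numbers has an
    infinite fiber.  Infinitude is expressed by arbitrarily long
    duplicate-free sequences, which is how it is consumed. *)
Definition has_infinite_fibers (K : eqType) :=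
  forall D : K -> nat, exists N, forall k,
    exists s : seq K, [/\ uniq s, size s = k & forall a, a \in s -> D a = N].

Section Nullstellensatz.
Context (K : closedFieldType) (n : nat) (uncK : has_infinite_fibers K).
Local Notation P := {mpoly K[n]}.
Implicit Types (I : P -> Prop) (h : P).

Lemma horner_alg_factor (i : 'I_n) (b : K) :
  horner_alg ('X_i : P) ('X - b%:P) = 'X_i - b%:MP.
Proof. by rewrite rmorphB /= horner_algX horner_algC alg_mpolyC. Qed.

(** One coordinate of the zero can be fixed without making h nilpotent modulo
    the enlarged ideal.  Otherwise 'X_i - a becomes invertible for every a once
    h is inverted.  By pigeonhole infinitely many of these inverses have the
    same degree bound, so they are linearly dependent; clearing denominators
    gives a nonzero univariate polynomial p with p('X_i) h^k in I, and its
    linear factors can be divided out one after the other. *)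
Lemma nullstellensatz_step I h (i : 'I_n) : ideal I ->
  (forall k, ~ I (h ^+ k)) ->
  exists a : K, forall k,
    ~ (exists u q, I u /\ h ^+ k = u + q * ('X_i - a%:MP)).
Proof.
move=> idI hI; apply: contrapT => noa.
have /choice[kq kqP] : forall a : K, exists kq : nat * P,
    I (h ^+ kq.1 - kq.2 * ('X_i - a%:MP)).
  move=> a; apply: contrapT => Na; apply: noa; exists a => k [u [q [Iu E]]].
  by apply: Na; exists (k, q); rewrite /= E addrK.
pose ev := horner_alg ('X_i : P).
have evI : forall p k, p != 0 -> ~ I (ev p * h ^+ k).
  move=> p; have [m] := ubnP (size p); elim: m p => // m IH p szp k p0 Ip.
  have [/size_poly1P[c c0 Ep]|] := boolP (size p == 1%N).
    apply: (hI k); have := idealMl idI c^-1%:MP Ip.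
    rewrite Ep /ev horner_algC alg_mpolyC mulrA -mpolyCM mulVf //.
    by rewrite mpolyC1 mul1r.
  move=> /closed_rootP[b /factor_theorem[q Eq]].
  have q0 : q != 0 by apply: contraNneq p0 => q0; rewrite Eq q0 mul0r.
  apply: (IH q _ (k + (kq b).1)%N) => //.
    by move: szp; rewrite Eq size_Mmonic ?monicXsubC // size_XsubC addn2.
  have := kqP b; set u := _ - _ => Iu.
  have -> : ev q * h ^+ (k + (kq b).1) =
      (ev q * h ^+ k) * u + (kq b).2 * (ev p * h ^+ k).
    by rewrite Eq [in RHS]/ev rmorphM /= horner_alg_factor -/ev exprD /u; ring.
  by apply: idealD => //; apply: idealMl.
(* Both the exponent of h and the degree of the inverse are made constant. *)
have [N NP] := uncK (fun a => pickle ((kq a).1, msize (kq a).2)).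
have [s2 [us2 szs2 s2P]] := NP 1%N.
case: s2 us2 szs2 s2P => [//|a0 s2] _ _ /(_ a0 (mem_head _ _)) EN.
pose D := msize (kq a0).2; pose k := (kq a0).1.
have [s [us szs sP]] := NP #|{: 'X_{1..n < D}}|.+1.
have kqE t : (t < size s)%N -> (kq s`_t).1 = k /\ msize (kq s`_t).2 = D.
  move=> ts; have := sP s`_t (mem_nth _ ts); rewrite -EN.
  by move=> /(pcan_inj pickleK)[-> ->].
have [l [[t0 lt0] _ lP]] := @lin_dep K 'I_(size s) 'X_{1..n < D} predT predT
  (fun t m => ((kq s`_t).2)@_m) ltac:(by rewrite card_ord szs).
have lq0 : \sum_(t < size s) (l t)%:MP * (kq s`_t).2 = 0.
  apply/mpolyP => m; rewrite mcoeff0 raddf_sum /=.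
  have [mD|Dm] := ltnP (mdeg m) D.
    rewrite -[RHS](lP (BMultinom mD) isT).
    by apply: eq_bigr => t _; rewrite mcoeffCM.
  apply: big1 => t _; rewrite mcoeffCM memN_msupp_eq0 ?mulr0 //.
  by apply: msize_mdeg_ge; rewrite (kqE _ (ltn_ord t)).2.
(* sum_t l_t / ('X - s_t) times the product of all the 'X - s_t *)
pose p : {poly K} := \sum_(t < size s) l t *: \prod_(t' < size s | t' != t)
  ('X - (s`_t')%:P).
have p0 : p != 0.
  apply/eqP => /(congr1 (fun p => p.[s`_t0])) /eqP; apply/negP.
  rewrite horner0 horner_sum (bigD1 t0) //= [X in _ + X]big1 ?addr0; last first.
    move=> t tt0; rewrite hornerZ horner_prod (bigD1 t0) 1?eq_sym //=.
    by rewrite hornerXsubC subrr mul0r mulr0.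
  rewrite hornerZ mulf_neq0 // horner_prod; apply/prodf_neq0 => t tt0.
  rewrite hornerXsubC subr_eq0 nth_uniq ?ltn_ord //.
  by rewrite eq_sym.
apply: (evI p k p0).
pose E := \prod_(t < size s) ('X_i - (s`_t)%:MP : P).
have -> : ev p * h ^+ k = \sum_(t < size s) ((l t)%:MP *
   (\prod_(t' < size s | t' != t) ('X_i - (s`_t')%:MP))) *
   (h ^+ (kq s`_t).1 - (kq s`_t).2 * ('X_i - (s`_t)%:MP)) +
   (\sum_(t < size s) (l t)%:MP * (kq s`_t).2) * E.
  rewrite /ev raddf_sum /= !mulr_suml -big_split /=; apply: eq_bigr => t _.
  have -> : E = ('X_i - (s`_t)%:MP) *
      \prod_(t' < size s | t' != t) ('X_i - (s`_t')%:MP).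
    by rewrite /E (bigD1 t).
  rewrite (kqE _ (ltn_ord t)).1 linearZ /= rmorph_prod /=.
  under eq_bigr => t' _ do rewrite horner_alg_factor.
  rewrite -mul_mpolyC.
  by ring.
rewrite lq0 mul0r addr0; apply: ideal_sum => // t _.
by apply: idealMl.
Qed.

(** Modulo the 'X_i - z_i a polynomial is congruent to its value at z. *)
Lemma ideal_eval I (z : 'I_n -> K) : ideal I ->
  (forall i, I ('X_i - (z i)%:MP)) -> forall p, I (p - p.@[z]%:MP).
Proof.
move=> idI Iz.
have IM p q : I (p - p.@[z]%:MP) -> I (q - q.@[z]%:MP) ->
    I (p * q - (p * q).@[z]%:MP).
  move=> Ip Iq; rewrite rmorphM mpolyCM.
  have -> : p * q - p.@[z]%:MP * q.@[z]%:MP =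
     q * (p - p.@[z]%:MP) + p.@[z]%:MP * (q - q.@[z]%:MP) by ring.
  by apply: idI.2 => //; apply: idealMl.
have I1 : I (1 - (1 : P).@[z]%:MP) by rewrite meval1 mpolyC1 subrr; exact: idI.1.
move=> p; elim/mpolyind: p => [|c m p _ _ IHp].
  by rewrite meval0 mpolyC0 subr0; exact: idI.1.
rewrite mevalD mevalZ mpolyCD mpolyCM -mul_mpolyC.
have -> : c%:MP * 'X_[m] + p - (c%:MP * 'X_[m].@[z]%:MP + p.@[z]%:MP) =
  c%:MP * ('X_[m] - 'X_[m].@[z]%:MP) + (p - p.@[z]%:MP) :> P by ring.
apply: idI.2 => //.
rewrite mpolyXE_id; apply: (big_ind (fun q => I (q - q.@[z]%:MP))) => // i _.
elim: (m i) => [|k IHk]; first by rewrite expr0.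
by rewrite exprS; apply: IM => //; rewrite mevalXU.
Qed.

Theorem nullstellensatz I h : ideal I -> (forall k, ~ I (h ^+ k)) ->
  exists z : 'I_n -> K, (forall f, I f -> f.@[z] = 0) /\ h.@[z] != 0.
Proof.
move=> idI hI.
have [J [z [idJ IJ hJ Jz]]] : exists (J : P -> Prop) (z : 'I_n -> K),
    [/\ ideal J, forall f, I f -> J f, forall k, ~ J (h ^+ k)
      & forall i, J ('X_i - (z i)%:MP)].
  suff /(_ n (leqnn n))[J [z [? ? ? Jz]]] : forall j, (j <= n)%N ->
      exists (J : P -> Prop) (z : 'I_n -> K),
      [/\ ideal J, forall f, I f -> J f, forall k, ~ J (h ^+ k)
      & forall i : 'I_n, (i < j)%N -> J ('X_i - (z i)%:MP)].
    by exists J, z; split => // i; apply: Jz.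
  elim=> [|j IH] jn; first by exists I, (fun=> 0); split.
  have [J [z [idJ IJ hJ Jz]]] := IH (ltnW jn).
  have [a aP] := nullstellensatz_step (Ordinal jn) idJ hJ.
  pose J' := fun x : P => exists u q, J u /\ x = u + q * ('X_(Ordinal jn) - a%:MP).
  have JJ' f : J f -> J' f by move=> Jf; exists f, 0; rewrite mul0r addr0.
  exists J', (fun i : 'I_n => if i == j :> nat then a else z i).
  split => [|f If|k|i]; [exact: ideal_adjoin|by apply/JJ'/IJ|exact: aP|].
  rewrite ltnS leq_eqVlt; have [ij _|ij /= ij'] := eqVneq (i : nat) j.
    exists 0, 1; split; first exact: idJ.1.
    by rewrite mul1r add0r; congr ('X_ _ - _); apply: val_inj.
  by apply/JJ'/Jz.
have Jev := ideal_eval idJ Jz.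
have noconst c : c != 0 -> ~ J c%:MP.
  move=> c0 Jc; apply: (hJ 0%N); rewrite expr0.
  by have := idealMl idJ c^-1%:MP Jc; rewrite -mpolyCM mulVf // mpolyC1.
exists z; split => [f /IJ Jf|].
  apply: contrapT => /eqP fz; apply: (noconst _ fz).
  by have := idealB idJ Jf (Jev f); rewrite opprB addrC subrK.
apply/negP => /eqP hz; apply: (hJ 1%N); rewrite expr1.
by have := Jev h; rewrite hz mpolyC0 subr0.
Qed.

End Nullstellensatz.

(** * The fiber cone of an isolated zero *)

Section LocalAlgebra.
Context (K : fieldType) (n : nat).
Local Notation P := {mpoly K[n]}.
Implicit Types (p q : P) (a b : 'X_{1..n}) (f : 'I_n -> P).

(** Membership in the L-th power of the maximal ideal of the origin. *)
Definition ordge L p := forall a, (mdeg a < L)%N -> p@_a = 0.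

Lemma ordge0 p : ordge 0 p. Proof. by []. Qed.

Lemma ordge_zero L : ordge L 0. Proof. by move=> a _; rewrite mcoeff0. Qed.

Lemma ordge_le L L' p : (L' <= L)%N -> ordge L p -> ordge L' p.
Proof. by move=> LL' pL a aL'; apply: pL; apply: leq_trans LL'. Qed.

Lemma ordgeD L p q : ordge L p -> ordge L q -> ordge L (p + q).
Proof. by move=> pL qL a aL; rewrite mcoeffD pL ?qL ?addr0. Qed.

Lemma ordgeM L L' p q : ordge L p -> ordge L' q -> ordge (L + L') (p * q).
Proof.
move=> pL qL' a aL; rewrite mcoeffM big1 // => -[a1 a2] /= /eqP Ea.
have [a1L|La1] := ltnP (mdeg a1) L; first by rewrite pL ?mul0r.
rewrite [q@__]qL' ?mulr0 //; have := congr1 mdeg Ea; rewrite mdegD.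
by lia.
Qed.

Lemma ordgeMl L p q : ordge L q -> ordge L (p * q).
Proof. by rewrite -[L in _ -> ordge L _]add0n; apply: ordgeM. Qed.

Lemma ordgeZ L (c : K) q : ordge L q -> ordge L (c *: q).
Proof. by rewrite -mul_mpolyC; apply: ordgeMl. Qed.

Lemma ordge_sum L (T : Type) (r : seq T) (Q : pred T) (F : T -> P) :
  (forall i, Q i -> ordge L (F i)) -> ordge L (\sum_(i <- r | Q i) F i).
Proof.
by move=> FL; elim/big_ind: _ => //; [exact: ordge_zero | exact: ordgeD].
Qed.

Lemma ordgeX a : ordge (mdeg a) 'X_[a].
Proof. by move=> b; rewrite mcoeffX; case: eqVneq => // ->; rewrite ltnn. Qed.

Lemma ordge_mmap1 f a : (forall i, ordge 1 (f i)) -> ordge (mdeg a) (mmap1 f a).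
Proof.
move=> f1; rewrite mdegE /mmap1; elim/big_rec2: _ => [//|i p L _ IHp].
apply: ordgeM => //; elim: (a i) => [//|k IH]; rewrite exprS -add1n.
exact: ordgeM.
Qed.

Lemma meval_at0 p : p.@[fun=> 0] = p@_0%MM.
Proof.
elim/mpolyind: p => [|c m p _ _ IH]; first by rewrite meval0 mcoeff0.
rewrite mevalD mevalZ mcoeffD mcoeffZ IH mcoeffX mevalX; congr (_ * _ + _).
rewrite -mdeg_eq0 mdegE sum_nat_eq0.
have [/forallP m0|/forallPn[i mi]] := boolP [forall (i | true), m i == 0%N].
  by apply: big1 => i _; have /eqP-> := m0 i.
by rewrite (bigD1 i) //= expr0n; move: mi => /= /negPf->; rewrite mul0r.
Qed.

Lemma ordge1P p : p.@[fun=> 0] = 0 <-> ordge 1 p.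
Proof.
rewrite meval_at0; split=> [p0 a|->//]; last by rewrite mdeg0.
by rewrite ltnS leqn0 mdeg_eq0 => /eqP->.
Qed.

Lemma mmap1D f a b : mmap1 f (a + b)%MM = mmap1 f a * mmap1 f b.
Proof.
by rewrite /mmap1 -big_split; apply: eq_bigr => i _; rewrite mnmDE exprD.
Qed.

(** The monomials f^a, with a of degree k, are linearly independent in
    (f)^k / M (f)^k when the origin is an isolated zero of f.  Let b be the
    largest exponent in a relation [rel].  Then f^b, hence any f^a with a >= b,
    can be replaced by smaller exponents of the same degree plus terms with a
    coefficient in M; and a monomial of degree at least kap can be replaced by
    an element of (f).  So modulo M^L the products of monomials of degree
    < kap with the f^a, where |a| < L and a is not a multiple of b, span
    everything.  There are O(L^(n-1)) of them, too few for the L^n growth of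
    the dimension of the polynomials modulo M^L. *)
Section FiberCone.
Context (f : 'I_n -> P) (kap k D : nat) (c : 'X_{1..n} -> K) (h : 'X_{1..n} -> P).
Hypothesis kD : (k < D)%N.
Hypothesis f1 : forall i, ordge 1 (f i).
(* M^kap lies in (f) + M^L for all L: this is what isolatedness means here. *)
Hypothesis isolated : forall L a, (kap <= mdeg a)%N ->
  exists q : 'I_n -> P, ordge L ('X_[a] - \sum_i q i * f i).
Hypothesis h1 : forall a, ordge 1 (h a).
Hypothesis rel : \sum_(a : 'X_{1..n < D} | mdeg a == k) c a *: mmap1 f a =
  \sum_(a : 'X_{1..n < D} | mdeg a == k) h a * mmap1 f a.

Definition mnm_of_ffun N (a : {ffun 'I_n -> 'I_N}) : 'X_{1..n} :=
  [multinom (a i : nat) | i < n].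

Section Spanning.
Context (b : 'X_{1..n}) (L : nat).
Hypotheses (degb : mdeg b = k) (cb : c b != 0).
Hypothesis maxb : forall a, mdeg a = k -> c a != 0 -> (a <= b)%O.

(** Exponents of the spanning family; boxes replace the simplices |m| < kap and
    |a| < L because only the order of growth in L matters. *)
Definition standard : pred ({ffun 'I_n -> 'I_kap} * {ffun 'I_n -> 'I_L}) :=
  fun j => [exists i, (j.2 i < b i)%N].

Definition spanned p :=
  exists C : {ffun 'I_n -> 'I_kap} * {ffun 'I_n -> 'I_L} -> K,
  ordge L (p - \sum_(j | standard j)
     C j *: ('X_[mnm_of_ffun j.1] * mmap1 f (mnm_of_ffun j.2))).

Lemma spanned_ordge p : ordge L p -> spanned p.
Proof.
move=> pL; exists (fun=> 0); rewrite big1 ?subr0 // => i _.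
by rewrite scale0r.
Qed.

Lemma spannedD p q : spanned p -> spanned q -> spanned (p + q).
Proof.
move=> [C pC] [C' qC']; exists (fun j => C j + C' j).
under eq_bigr => j _ do rewrite scalerDl.
by rewrite big_split opprD addrACA; apply: ordgeD.
Qed.

Lemma spannedZ x p : spanned p -> spanned (x *: p).
Proof.
move=> [C pC]; exists (fun j => x * C j).
under eq_bigr => j _ do rewrite -scalerA.
by rewrite -scaler_sumr -scalerBr; apply: ordgeZ.
Qed.

Lemma spanned_sum (T : Type) (r : seq T) (Q : pred T) (F : T -> P) :
  (forall i, Q i -> spanned (F i)) -> spanned (\sum_(i <- r | Q i) F i).
Proof.
move=> FL; elim/big_ind: _ => //; [exact/spanned_ordge/ordge_zero|exact: spannedD].
Qed.

Lemma spanned_mul t a q :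
  (forall m, (t <= mdeg m)%N -> spanned ('X_[m] * mmap1 f a)) ->
  ordge t q -> spanned (q * mmap1 f a).
Proof.
move=> Ht qt; rewrite [q]mpolyE big_seq mulr_suml; apply: spanned_sum => m mq.
rewrite -scalerAl; apply/spannedZ/Ht; rewrite leqNgt; apply: contraTN mq => /qt.
by rewrite mcoeff_msupp negbK => ->.
Qed.

Lemma spanned_standard m a : (mdeg m < kap)%N -> (mdeg a < L)%N ->
  ~~ (b <= a)%MM -> spanned ('X_[m] * mmap1 f a).
Proof.
move=> mk aL ba.
have le_mdeg (x : 'X_{1..n}) i : (x i <= mdeg x)%N.
  by rewrite mdegE (bigD1 i) //= leq_addr.
pose j := ([ffun i => Ordinal (leq_ltn_trans (le_mdeg m i) mk)],
           [ffun i => Ordinal (leq_ltn_trans (le_mdeg a i) aL)]).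
have jP : standard j.
  move: ba; rewrite /standard; apply: contraR => /existsPn jP.
  by apply/mnm_lepP => i; have := jP i; rewrite /= ffunE /= -leqNgt.
exists (fun j' => (j' == j)%:R); rewrite (bigD1 j) //= eqxx scale1r.
have -> : mnm_of_ffun j.1 = m by apply/mnmP => i; rewrite mnmE ffunE.
have -> : mnm_of_ffun j.2 = a by apply/mnmP => i; rewrite mnmE ffunE.
rewrite big1 ?addr0 ?subrr; first exact: ordge_zero.
by move=> j' /andP[_ /negPf->]; rewrite scale0r.
Qed.

Lemma leading_relation : mmap1 f b =
  \sum_(a : 'X_{1..n < D} | (mdeg a == k) && (bmnm a < b)%O)
     (- (c b)^-1 * c a) *: mmap1 f a +
  \sum_(a : 'X_{1..n < D} | mdeg a == k) ((c b)^-1 *: h a) * mmap1 f a.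
Proof.
have bk : (mdeg b < D)%N by rewrite degb.
have := congr1 (fun p => (c b)^-1 *: p) rel; rewrite /= !scaler_sumr.
rewrite (bigD1 (BMultinom bk)) /= ?degb // !scalerA mulVf // scale1r.
under [X in _ = X -> _]eq_bigr => a _ do rewrite scalerAl.
move=> <-; rewrite addrCA -[LHS]addr0; congr (_ + _); apply/esym.
rewrite [X in _ + X](bigID (fun a : 'X_{1..n < D} => (bmnm a < b)%O)) /=.
rewrite [X in _ + (_ + X)]big1 ?addr0; last first.
  move=> a /andP[/andP[/eqP ak ab]] ab'; rewrite scalerA.
  have [->|ca] := eqVneq (c a) 0; first by rewrite mulr0 scale0r.
  have := maxb ak ca; rewrite le_eqVlt (negPf ab') orbF.
  by move=> /eqP ab0; move: ab; rewrite bmeqP /= ab0 eqxx.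
have -> : \sum_(i : 'X_{1..n < D} | (mdeg i == k) && (i != BMultinom bk)
    && (bmnm i < b)%O) (c b)^-1 *: (c i *: mmap1 f i) =
  \sum_(a : 'X_{1..n < D} | (mdeg a == k) && (bmnm a < b)%O)
    (c b)^-1 *: (c a *: mmap1 f a).
  apply: eq_bigl => a; rewrite -andbA; congr (_ && _).
  by rewrite bmeqP /=; case: ltP => //; rewrite ?andbT ?andbF //= => /lt_eqF->.
rewrite -big_split big1 //= => a _.
by rewrite scalerA mulNr scaleNr addNr.
Qed.

(** The rewriting terminates because every replacement raises the degree of a
    (up to L), or keeps it and raises the degree of the monomial (up to L), or
    keeps both and lowers a: hence the three nested inductions. *)
Lemma spanned_all a m : spanned ('X_[m] * mmap1 f a).
Proof.
have high_a a' m' : (L <= mdeg a')%N -> spanned ('X_[m'] * mmap1 f a').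
  move=> La; apply/spanned_ordge/ordgeMl/(ordge_le La)/ordge_mmap1 => //.
have high_m a' m' : (L <= mdeg m')%N -> spanned ('X_[m'] * mmap1 f a').
  by move=> Lm; apply/spanned_ordge; rewrite mulrC; apply/ordgeMl/(ordge_le Lm)/ordgeX.
suff H d1 d2 : forall a m, (L - mdeg a <= d1)%N -> (L - mdeg m <= d2)%N ->
    spanned ('X_[m] * mmap1 f a) by apply: (H L L); rewrite leq_subr.
elim: d1 d2 => [|d1 IH1] d2 {}a {}m.
  by rewrite leqn0 subn_eq0 => La _; apply: high_a.
elim: d2 a m => [|d2 IH2] a m.
  by rewrite leqn0 subn_eq0 => _; apply: high_m.
move: a m; apply: (well_founded_ind (@ltom_wf n)) => a IH3 m da dm.
have [ba|ba] := boolP (b <= a)%MM; last first.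
  have [aL|] := ltnP (mdeg a) L; last exact: high_a.
  have [mk|] := ltnP (mdeg m) kap; first exact: spanned_standard.
  move=> /(isolated L)[q]; set r := _ - _ => rL.
  have -> : 'X_[m] = \sum_i q i * f i + r by rewrite /r addrC subrK.
  rewrite mulrDl; apply: spannedD; last first.
    by apply: spanned_ordge; rewrite mulrC; apply: ordgeMl.
  rewrite mulr_suml; apply: spanned_sum => i _.
  rewrite -mulrA -[f i]mmap1U -mmap1D; apply: spanned_mul (ordge0 _) => m' _.
  by apply: (IH1 L); rewrite ?leq_subr // mdegD mdeg1; lia.
have mdegba (a' : 'X_{1..n}) : mdeg a' = k -> mdeg (a' + (a - b))%MM = mdeg a.
  by move=> a'k; rewrite mdegD a'k -degb -mdegD addmC submK.
rewrite -[in mmap1 f a](submK ba) addmC mmap1D leading_relation mulrDl mulrDr.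
rewrite !mulr_suml !mulr_sumr; apply: spannedD; apply: spanned_sum => a'.
  move=> /andP[/eqP ak ab]; rewrite -scalerAl -scalerAr -mmap1D.
  apply/spannedZ/IH3 => //; last by rewrite mdegba.
  by rewrite -[X in (_ < X)%O](submK ba) addmC ltmc_add2r.
move=> /eqP ak; rewrite -mulrA -mmap1D mulrA.
apply: (@spanned_mul (mdeg m + 1)).
  by move=> m' mm'; apply: IH2; rewrite ?mdegba //; lia.
by apply: ordgeM; [exact: ordgeX | apply: ordgeZ].
Qed.

End Spanning.

Lemma card_ord_lt L m : (#|[pred x : 'I_L | (x < m)%N]| <= m)%N.
Proof.
have [mL|Lm] := leqP m L; last first.
  by apply: leq_trans (max_card _) _; rewrite card_ord ltnW.
rewrite -sum1_card (eq_bigl (fun x : 'I_L => (x < m)%N)) //.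
by rewrite -(big_ord_widen _ (fun=> 1%N) mL) sum1_card card_ord.
Qed.

Lemma card_standard b L :
  (#|standard b (L := L)| <= kap ^ n * (mdeg b * L ^ n.-1))%N.
Proof.
pose B (i : 'I_n) := [pred x : {ffun 'I_n -> 'I_L} | (x i < b i)%N].
have -> : #|standard b (L := L)| =
    (#|{ffun 'I_n -> 'I_kap}| * #|[pred x | [exists i, B i x]]|)%N.
  by rewrite -cardX; apply: eq_card => -[y x]; rewrite !inE.
rewrite card_ffun !card_ord leq_mul2l; apply/orP; right.
apply: (@leq_trans (\sum_i #|B i|)).
  rewrite -sum1_card (eq_bigr (fun i => (\sum_(x | B i x) 1)%N)); last first.
    by move=> i _; rewrite sum1_card.
  rewrite (exchange_big_dep (fun x => [exists i, B i x])) /=; last first.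
    by move=> i x _ xi; apply/existsP; exists i.
  by apply: leq_sum => x /existsP[i xi]; rewrite (bigD1 i).
rewrite mdegE big_distrl /=; apply: leq_sum => i _.
have -> : #|B i| = #|family (fun i' => if i' == i then [pred x : 'I_L | (x < b i)%N]
    else predT)|.
  apply: eq_card => x; rewrite !inE; apply/idP/familyP => [xi i'|/(_ i)].
    by case: eqP => [->|].
  by rewrite eqxx.
rewrite card_family foldrE big_image /= (bigD1 i) //= eqxx leq_mul //.
  exact: card_ord_lt.
rewrite (eq_bigr (fun=> L)); last by move=> i' /negPf->; rewrite card_ord.
by rewrite prod_nat_const cardC1 card_ord.
Qed.

Lemma fiber_cone_free a : (0 < n)%N -> mdeg a = k -> c a = 0.
Proof.
move=> n0 ak; apply/eqP; apply: contraT => ca.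
have a_bound : (mdeg a < D)%N by rewrite ak.
pose Q (x : 'X_{1..n < D}) := (mdeg x == k) && (c x != 0).
have [|[b bk] /= /andP[/eqP degb cb] maxb] :=
  @arg_maxP _ _ _ (BMultinom a_bound) Q (fun x => x : 'X_{1..n}).
  by rewrite /Q /= ak eqxx.
(* L' makes the L'^n monomials of a box outnumber the spanning family. *)
pose L' := (kap ^ n * (k * n ^ n.-1)).+1; pose L := (n * L')%N.
have span (x : {ffun 'I_n -> 'I_L'}) : spanned b L 'X_[mnm_of_ffun x].
  rewrite -[X in spanned _ _ X]mulr1 -(mmap11 f); apply: spanned_all => // y yk cy.
  have yb : (mdeg y < D)%N by rewrite yk.
  by apply: (maxb (BMultinom yb)); rewrite /Q /= yk eqxx.
have /choice[C CP] := span.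
have [|l [[x lx] _ lP]] := @lin_dep _ _ _ predT (standard b (L := L)) C.
  apply: leq_ltn_trans (card_standard _ _) _.
  rewrite card_ffun !card_ord degb expnMn !mulnA -[in X in (_ < X)%N](prednK n0).
  by rewrite expnS ltn_mul2r expn_gt0 /= /L' !mulnA ltnSn.
suff : l x = 0 by move/eqP; rewrite (negPf lx).
have xL : (mdeg (mnm_of_ffun x) < L)%N.
  apply: (@leq_ltn_trans (n * L'.-1)); last by rewrite /L ltn_mul2l n0 /=.
  have -> : (n * L'.-1 = \sum_(i < n) L'.-1)%N by rewrite sum_nat_const card_ord.
  by rewrite mdegE; apply: leq_sum => i _; rewrite mnmE -ltnS.
have /(_ _ xL) : ordge L (\sum_y l y *: 'X_[mnm_of_ffun y]).
  pose W (j : {ffun 'I_n -> 'I_kap} * {ffun 'I_n -> 'I_L}) : P :=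
    'X_[mnm_of_ffun j.1] * mmap1 f (mnm_of_ffun j.2).
  have -> : \sum_y l y *: 'X_[mnm_of_ffun y] =
      \sum_y l y *: ('X_[mnm_of_ffun y] - \sum_(j | standard b j) C y j *: W j).
    under [RHS]eq_bigr => y _ do rewrite scalerBr scaler_sumr.
    rewrite sumrB exchange_big /= [X in _ - X]big1 ?subr0 // => j jb.
    under eq_bigr => y _ do rewrite scalerA.
    by rewrite -scaler_suml lP ?scale0r.
  by apply: ordge_sum => y _; apply/ordgeZ/CP.
rewrite raddf_sum /= (bigD1 x) //= mcoeffZ mcoeffX eqxx mulr1 big1 ?addr0 //.
move=> y yx; rewrite mcoeffZ mcoeffX; case: eqVneq => [E|_]; last by rewrite mulr0.
case/eqP: yx; apply/ffunP => i; apply/val_inj.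
by have := congr1 (fun m : 'X_{1..n} => m i) E; rewrite !mnmE.
Qed.

End FiberCone.
End LocalAlgebra.

(** * Independence of products at isolated zeros *)

Section IsolatedZeros.
Context (K : closedFieldType) (n : nat) (uncK : has_infinite_fibers K).
Local Notation P := {mpoly K[n]}.
Implicit Types (p q g : P) (a : 'X_{1..n}) (f : 'I_n -> P) (z : 'rV[K]_n).

Definition ideal_of f p := exists q : 'I_n -> P, p = \sum_i q i * f i.

Lemma ideal_of_ideal f : ideal (ideal_of f).
Proof.
split; first by exists (fun=> 0); rewrite big1 // => i _; rewrite mul0r.
move=> x _ _ [q ->] [q' ->]; exists (fun i => x * q i + q' i).
rewrite mulr_sumr -big_split; apply: eq_bigr => i _.
by rewrite mulrDl mulrA.
Qed.

Lemma ideal_of_gen f i : ideal_of f (f i).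
Proof.
exists (fun j => (j == i)%:R); rewrite (bigD1 i) //= eqxx mul1r big1 ?addr0 //.
by move=> j /negPf->; rewrite mul0r.
Qed.

(** Geometric series. *)
Lemma inverse_mod_ordge L w : w.@[fun=> 0] != 0 :> K ->
  exists u : P, ordge L (1 - u * w).
Proof.
set c := w.@[_] => c0; pose y := 1 - c^-1%:MP * w : P.
have y1 : ordge 1 y.
  by apply/ordge1P; rewrite rmorphB /= rmorph1 rmorphM /= mevalC mulVf ?subrr.
exists (c^-1%:MP * \sum_(j < L) y ^+ j).
have -> : 1 - c^-1%:MP * (\sum_(j < L) y ^+ j) * w = y ^+ L.
  have -> : c^-1%:MP * (\sum_(j < L) y ^+ j) * w = - ((y - 1) * \sum_(j < L) y ^+ j).
    by rewrite /y; ring.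
  by rewrite -subrX1; ring.
elim: L => [|L IH]; first exact: ordge0.
by rewrite exprS -add1n; apply: ordgeM.
Qed.

Definition common_zero f g z := (forall i, (f i).@[z 0] = 0) /\ g.@[z 0] != 0.

(** Let h_i be g 'X_i times the factors 'X_i - z_i for the finitely many other
    values z_i of the i-th coordinate on the zeros.  It vanishes on the common
    zeros of f, so a power of it lies in (f); locally at the origin it is
    'X_i up to a unit. *)
Lemma isolated_at0 f g :
  (exists Z : seq 'rV[K]_n, forall z, common_zero f g z -> z \in Z) ->
  common_zero f g 0 ->
  exists kap, forall L a, (kap <= mdeg a)%N ->
    exists q : 'I_n -> P, ordge L ('X_[a] - \sum_i q i * f i).
Proof.
move=> [Z ZP] [f0 g0].
have ev0 (p : P) : p.@[(0 : 'rV[K]_n) 0] = p.@[fun=> 0].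
  by apply: meval_eq => i; rewrite mxE.
pose w i : P := g * \prod_(z <- Z) (if z 0 i == 0 then 1 else 'X_i - (z 0 i)%:MP).
have w0 i : (w i).@[fun=> 0] != 0.
  rewrite rmorphM mulf_neq0 //= -?ev0 // (rmorph_prod (meval _)).
  rewrite prodf_seq_neq0; apply/allP => z _ /=.
  case: (eqVneq (z 0 i) 0) => [_|zi]; first by rewrite rmorph1 oner_eq0.
  by rewrite rmorphB /= mevalXU mevalC mxE sub0r oppr_eq0.
have /choice[k kP] : forall i, exists k, ideal_of f ((w i * 'X_i) ^+ k).
  move=> i; apply: contrapT => /forallNP Nk.
  have [z [fz]] := nullstellensatz uncK (ideal_of_ideal f) Nk.
  pose z' : 'rV[K]_n := \row_j z j.
  have evz (p : P) : p.@[z] = p.@[z' 0] by apply: meval_eq => j; rewrite mxE.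
  rewrite evz /w !rmorphM !mulf_eq0 !negb_or => /andP[/andP[gz pz] zi].
  have /ZP zZ : common_zero f g z'.
    by split => // j; rewrite -evz; apply/fz/ideal_of_gen.
  move: pz; rewrite (rmorph_prod (meval (z' 0))) prodf_seq_neq0.
  move=> /allP/(_ z' zZ) /=.
  move: zi; rewrite /= mevalXU => /negPf->.
  by rewrite rmorphB /= mevalXU mevalC subrr eqxx.
(* A monomial of degree above sum_i k_i is divisible by some 'X_i ^+ k_i. *)
exists (\sum_i k i).+1 => L a.
rewrite mdegE => ka; have [i ki] : exists i, (k i <= a i)%N.
  apply/existsP; apply: contraTT ka => /existsPn ka; rewrite -leqNgt.
  by apply: leq_sum => i _; rewrite ltnW // ltnNge ka.
have [q Eq] := kP i.
have [|u uP] := @inverse_mod_ordge L (w i ^+ k i).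
  by rewrite rmorphXn expf_neq0 // w0.
have Ea : a = (U_(i) *+ k i + (a - U_(i) *+ k i))%MM.
  apply/mnmP => j; rewrite mnmDE mnmBE mulmnE mnm1E.
  by have [<-|_] := eqVneq i j; rewrite ?mul1n ?mul0n; lia.
pose a' := (a - U_(i) *+ k i)%MM.
exists (fun j => u * 'X_[a'] * q j).
have -> : \sum_j u * 'X_[a'] * q j * f j = u * 'X_[a'] * (w i * 'X_i) ^+ k i.
  by rewrite Eq mulr_sumr; apply: eq_bigr => j _; rewrite !mulrA.
have -> : 'X_[a] = 'X_[a'] * 'X_i ^+ k i :> P.
  by rewrite {1}Ea mpolyXD -mpolyXn mulrC.
rewrite exprMn.
have -> : 'X_[a'] * 'X_i ^+ k i - u * 'X_[a'] * (w i ^+ k i * 'X_i ^+ k i) =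
  'X_[a'] * 'X_i ^+ k i * (1 - u * w i ^+ k i) :> P by ring.
exact: ordgeMl.
Qed.

Definition translate z p : P := p \mPo [tuple 'X_i + (z 0 i)%:MP | i < n].

Lemma translateE z z' p : (translate z p).@[z' 0] = p.@[(z' + z) 0].
Proof.
rewrite comp_mpoly_meval; apply: meval_eq => i.
by rewrite tnth_mktuple mevalD mevalXU mevalC mxE.
Qed.

Lemma translate_mmap1 z f a :
  translate z (mmap1 f a) = mmap1 (fun i => translate z (f i)) a.
Proof. by rewrite /translate rmorph_prod; apply: eq_bigr => i _; rewrite rmorphXn. Qed.

Lemma independent_leading_forms f g z k D (c : 'X_{1..n} -> K) (h : 'X_{1..n} -> P) :
  (0 < n)%N -> (k < D)%N ->
  (exists Z : seq 'rV[K]_n, forall z, common_zero f g z -> z \in Z) ->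
  common_zero f g z -> (forall a, (h a).@[z 0] = 0) ->
  \sum_(a : 'X_{1..n < D} | mdeg a == k) c a *: mmap1 f a =
  \sum_(a : 'X_{1..n < D} | mdeg a == k) h a * mmap1 f a ->
  forall a, mdeg a = k -> c a = 0.
Proof.
move=> n0 kD [Z ZP] z0 hz rel a ak.
pose f' i := translate z (f i); pose g' := translate z g.
have cz z' : common_zero f' g' z' <-> common_zero f g (z' + z).
  by rewrite /common_zero translateE; split=> -[fz gz]; split=> // i;
    have := fz i; rewrite translateE.
have [||kap kapP] := @isolated_at0 f' g'.
- exists [seq x - z | x <- Z] => z' /cz /ZP z'Z.
  by apply/mapP; exists (z' + z); rewrite ?addrK.
- by apply/cz; rewrite add0r.
have at0 (p : P) : p.@[z 0] = 0 -> ordge 1 (translate z p).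
  move=> pz; apply/ordge1P; apply: etrans pz.
  rewrite -[in RHS](add0r z) -translateE; by apply: meval_eq => i; rewrite mxE.
refine (@fiber_cone_free _ _ f' kap k D c (fun a => translate z (h a)) kD _ kapP
  _ _ a n0 ak).
- by move=> i; apply: at0 (z0.1 i).
- by move=> b; apply: at0 (hz b).
have := congr1 (translate z) rel; rewrite /translate !raddf_sum /=.
under eq_bigr => b _ do rewrite linearZ /= -/(translate z _) translate_mmap1.
by under [X in _ = X -> _]eq_bigr => b _ do
  rewrite rmorphM /= -!/(translate z _) translate_mmap1.
Qed.

Lemma mnm_sub_deg a k : (k <= mdeg a)%N -> exists2 b, (b <= a)%MM & mdeg b = k.
Proof.
move En : (mdeg a - k)%N => m; elim: m a En => [|m IH] a En ka.
  by exists a; [exact: lepm_refl | lia].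
have [i ai] : exists i, a i != 0%N.
  apply/existsP; rewrite -negb_forall; apply/negP => /forallP a0.
  by move: En ka; rewrite mdegE big1 // => i _; apply/eqP/a0.
have Ea : (a - U_(i) + U_(i))%MM = a by apply: submK; rewrite lep1mP.
have degE : (mdeg (a - U_(i))%MM + 1 = mdeg a)%N by rewrite -[in RHS]Ea mdegD mdeg1.
have [||b ba bk] := IH (a - U_(i))%MM; [lia|lia|].
by exists b => //; apply: lepm_trans ba (lem_subr _ _).
Qed.

(** Take the lowest degree k of an exponent a occurring in a relation, and j
    such that lam j a <> 0 for some a of degree k.  Modulo M (f)^k, where M is
    the maximal ideal of z_j, the terms with another index or a higher degree
    disappear and e_j may be replaced by its value at z_j.  This leaves a form
    in (f)^k that contradicts [independent_leading_forms]. *)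
Lemma powers_independent f g (N : nat) (z : 'I_N -> 'rV[K]_n) (e : 'I_N -> P) D
    (lam : 'I_N -> 'X_{1..n} -> K) :
  (0 < n)%N ->
  (exists Z : seq 'rV[K]_n, forall z, common_zero f g z -> z \in Z) ->
  (forall j, common_zero f g (z j)) ->
  (forall i j, i != j -> (e i).@[z j 0] = 0) ->
  (forall j, (e j).@[z j 0] != 0) ->
  \sum_j \sum_(a : 'X_{1..n < D}) lam j a *: (e j * mmap1 f a) = 0 ->
  forall j a, (mdeg a < D)%N -> lam j a = 0.
Proof.
move=> n0 fin zP e0 e1 rel j' a' a'D; apply/eqP; apply: contraT => lam'.
pose Q (x : 'I_N * 'X_{1..n < D}) := lam x.1 x.2 != 0.
have [//|[j0 [a0 a0D]] /= lam0 min0] :=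
  @arg_minnP _ (j', BMultinom a'D) Q (fun x => mdeg x.2).
(* M p means that p lies in the product of (f)^k with the maximal ideal of z_j0. *)
pose k := mdeg a0; pose M p := exists h : 'X_{1..n} -> P,
  (forall a, (h a).@[z j0 0] = 0) /\
  p = \sum_(a : 'X_{1..n < D} | mdeg a == k) h a * mmap1 f a.
have M0 : M 0.
  exists (fun=> 0); split=> [a|]; first exact: meval0.
  by rewrite big1 // => a _; rewrite mul0r.
have MD p q : M p -> M q -> M (p + q).
  move=> [h [hz ->]] [h' [hz' ->]]; exists (fun a => h a + h' a).
  split=> [a|]; first by rewrite mevalD hz hz' addr0.
  by rewrite -big_split; apply: eq_bigr => a _; rewrite mulrDl.
have Msum (T : finType) (R : pred T) (F : T -> P) :
    (forall i, R i -> M (F i)) -> M (\sum_(i | R i) F i).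
  by move=> FM; elim/big_ind: _.
have Mk p (a : 'X_{1..n < D}) : p.@[z j0 0] = 0 -> mdeg a = k -> M (p * mmap1 f a).
  move=> pz ak; exists (fun b : 'X_{1..n} => if b == bmnm a then p else 0).
  split=> [b|]; first by case: eqP => // _; exact: meval0.
  rewrite (bigD1 a) /= ?ak // eqxx big1 ?addr0 // => b /andP[_].
  by rewrite bmeqP => /negPf->; rewrite mul0r.
have Mgt p (a : 'X_{1..n < D}) : (k < mdeg a)%N -> M (p * mmap1 f a).
  move=> ka; have [b ba bk] := mnm_sub_deg (ltnW ka).
  have bD : (mdeg b < D)%N by rewrite bk (ltn_trans ka) // bmdeg.
  rewrite -(submK ba) mmap1D mulrA; apply: (Mk _ (BMultinom bD)) => //.
  have : mdeg (a - b)%MM != 0%N.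
    have := congr1 mdeg (submK ba); rewrite mdegD bk; lia.
  rewrite mdeg_eq0 mevalM => ab0.
  have [i abi] : exists i, (a - b)%MM i != 0%N.
    apply/existsP; rewrite -negb_forall; apply: contra ab0 => /forallP ab0.
    by apply/eqP/mnmP => i; rewrite mnm0E; apply/eqP/ab0.
  rewrite /mmap1 rmorph_prod (bigD1 i) //= rmorphXn /= (zP j0).1 expr0n.
  by rewrite (negPf abi) mul0r mulr0.
have [h [hz Eh]] : M (\sum_(a : 'X_{1..n < D} | mdeg a == k)
    ((e j0).@[z j0 0] * lam j0 a) *: mmap1 f a).
  have -> : \sum_(a : 'X_{1..n < D} | mdeg a == k)
      ((e j0).@[z j0 0] * lam j0 a) *: mmap1 f a =
    \sum_j \sum_(a : 'X_{1..n < D})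
      ((if (j == j0) && (mdeg a == k) then
         ((e j0).@[z j0 0] * lam j0 a) *: mmap1 f a else 0) -
       lam j a *: (e j * mmap1 f a)).
    under [RHS]eq_bigr => j _ do rewrite sumrB.
    rewrite sumrB rel subr0 [RHS](bigD1 j0) //= [X in _ + X]big1 ?addr0.
      by rewrite eqxx -big_mkcond.
    by move=> j /negPf->; apply: big1.
  apply: (Msum) => j _; apply: (Msum) => a _.
  have -> : lam j a *: (e j * mmap1 f a) = (lam j a)%:MP * e j * mmap1 f a.
    by rewrite -mul_mpolyC mulrA.
  have [l0|lja] := eqVneq (lam j a) 0.
    rewrite l0 mpolyC0 !mul0r subr0; case: ifP => // /andP[/eqP jj0 _].
    by rewrite -jj0 l0 mulr0 scale0r.
  have := min0 (j, a) lja; rewrite /= leq_eqVlt => /orP[/eqP ak|ka]; last first.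
    by rewrite gtn_eqF // andbF sub0r -mulNr; apply: Mgt.
  rewrite -ak eqxx andbT; case: eqVneq => [jj0|jj0]; last first.
    rewrite sub0r -mulNr; apply: Mk; rewrite // mevalN mevalM (e0 _ _ jj0).
    by rewrite mulr0 oppr0.
  rewrite -mul_mpolyC -mulrBl; apply: Mk; rewrite // mevalB mevalC mevalM mevalC.
  by rewrite jj0 mulrC subrr.
have := @independent_leading_forms f g (z j0) k D
  (fun a => (e j0).@[z j0 0] * lam j0 a) h n0 a0D fin (zP j0) hz Eh a0 erefl.
by move/eqP; rewrite mulf_eq0 (negPf (e1 j0)) /= => l0;
  rewrite /Q /= l0 in lam0.
Qed.

End IsolatedZeros.

(** * Bezout's inequality *)

Lemma msizeM_leq (F : idomainType) n (p q : {mpoly F[n]}) :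
  (msize (p * q) <= (msize p + msize q).-1)%N.
Proof.
have [->|p0] := eqVneq p 0; first by rewrite mul0r msize0.
have [->|q0] := eqVneq q 0; first by rewrite mulr0 msize0.
by rewrite msizeM.
Qed.

Section BezoutBound.
Context (K : closedFieldType) (n : nat) (uncK : has_infinite_fibers K).
Local Notation P := {mpoly K[n]}.

(** With d the product of the degrees, this is what rules out the growth
    forced by one zero too many.  As (1 + 1/d)^d >= 2, it is enough to compare
    2^t with a polynomial in t. *)
Lemma exp_beats_poly (d E : nat) : (0 < n)%N -> (0 < d)%N ->
  exists j, (d ^ j * (j * E).+1 ^ n < d.+1 ^ j)%N.
Proof.
move=> n0 d0; pose Q := (d * n * E)%N; pose s := (3 * Q.+1)%N.
exists (d * (n * s))%N.
have lt2 : ((d * (n * s) * E).+1 < 2 ^ s)%N.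
  have -> : (d * (n * s) * E = Q * s)%N by rewrite /Q; nia.
  have H : (Q.+2 <= 2 ^ Q.+1)%N by apply: ltn_expl.
  have -> : (2 ^ s = 2 ^ Q.+1 * (2 ^ Q.+1 * 2 ^ Q.+1))%N.
    by rewrite -!expnD; congr (_ ^ _)%N; rewrite /s; lia.
  apply: (@leq_trans (Q.+2 * (Q.+2 * Q.+2))); first by rewrite /s; nia.
  by rewrite !leq_mul.
have dbl : (2 * d ^ d <= d.+1 ^ d)%N.
  rewrite -[d.+1]addn1 expnDn.
  case: d d0 {Q s lt2} => // d _.
  rewrite big_ord_recl big_ord_recl /= bin0 bin1 subn0 !exp1n /bump /=.
  rewrite !muln1 mul1n add1n subn1 /= addnA.
  by apply: leq_trans (leq_addr _ _); rewrite expnS; lia.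
apply: (@leq_trans (2 ^ (n * s) * d ^ (d * (n * s)))).
  rewrite [X in (X < _)%N]mulnC ltn_pmul2r ?expn_gt0 ?d0 //.
  by rewrite [X in (_ < 2 ^ X)%N]mulnC expnM ltn_exp2r.
by rewrite !(expnM _ d) -expnMn leq_exp2r // muln_gt0 n0.
Qed.

Lemma card_mnm_lt D : (#|{: 'X_{1..n < D}}| <= D ^ n)%N.
Proof.
have le_mdeg (x : 'X_{1..n}) i : (x i <= mdeg x)%N.
  by rewrite mdegE (bigD1 i) //= leq_addr.
pose F (x : 'X_{1..n < D}) : {ffun 'I_n -> 'I_D} :=
  [ffun i => Ordinal (leq_ltn_trans (le_mdeg x i) (bmdeg x))].
have injF : injective F.
  move=> x y /ffunP E; apply/val_inj/mnmP => i.
  by have := congr1 val (E i); rewrite !ffunE.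
by have := leq_card F injF; rewrite card_ffun !card_ord.
Qed.

Definition wdeg (d : 'I_n -> nat) (a : 'X_{1..n}) := (\sum_i d i * a i)%N.

(** Dividing each exponent by d_i sends a monomial of degree < D to one of
    weighted degree < D, and the remainders tell apart the monomials with the
    same quotient. *)
Lemma card_wdeg (d : 'I_n -> nat) D : (forall i, (0 < d i)%N) ->
  (#|{: 'X_{1..n < D}}| <=
   #|[pred a : 'X_{1..n < D} | (wdeg d a < D)%N]| * \prod_i d i)%N.
Proof.
move=> d0.
have le_mdeg (x : 'X_{1..n}) i : (x i <= mdeg x)%N.
  by rewrite mdegE (bigD1 i) //= leq_addr.
pose quo (x : 'X_{1..n}) := [multinom x i %/ d i | i < n]%N.
have quoD (x : 'X_{1..n < D}) : (mdeg (quo x) < D)%N.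
  apply: leq_ltn_trans (bmdeg x); rewrite !mdegE; apply: leq_sum => i _.
  by rewrite mnmE leq_div.
have remD (x : 'X_{1..n < D}) i : (x i %% d i < D)%N.
  by apply: leq_ltn_trans (leq_mod _ _) (leq_ltn_trans (le_mdeg x i) (bmdeg x)).
pose F (x : 'X_{1..n < D}) :=
  (BMultinom (quoD x), [ffun i => Ordinal (remD x i)] : {ffun 'I_n -> 'I_D}).
have injF : injective F.
  move=> x y Exy; apply/val_inj/mnmP => i.
  have := congr1 (fun u => (bmnm u.1) i) Exy; rewrite /= !mnmE => q.
  have := congr1 (fun u : _ * {ffun 'I_n -> 'I_D} => (u.2 i : nat)) Exy.
  rewrite /= !ffunE /= => r.
  by rewrite (divn_eq (bmnm x i) (d i)) [RHS](divn_eq _ (d i)) q r.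
pose R := family (fun i => [pred x : 'I_D | (x < d i)%N]).
rewrite -(card_imset _ injF).
apply: (@leq_trans #|[predX [pred a : 'X_{1..n < D} | (wdeg d a < D)%N] & R]|).
  apply/subset_leq_card/fintype.subsetP => _ /imsetP[x _ ->].
  apply/andP; split => /=.
    rewrite inE; apply: leq_ltn_trans (bmdeg x); rewrite mdegE; apply: leq_sum => i _.
    by rewrite mnmE mulnC leq_divM.
  by apply/familyP => i; rewrite inE ffunE /= ltn_mod.
rewrite cardX leq_mul2l; apply/orP; right.
rewrite card_family foldrE big_image /=; apply: leq_prod => i _.
exact: card_ord_lt.
Qed.

Lemma msize_mmap1 (f : 'I_n -> P) d a : (forall i, (msize (f i) <= (d i).+1)%N) ->
  (msize (mmap1 f a) <= (wdeg d a).+1)%N.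
Proof.
move=> fd; rewrite /mmap1 /wdeg; elim/big_rec2: _ => [|i p s _ IH].
  by rewrite msize1.
apply: leq_trans (msizeM_leq _ _) _.
suff H : (msize (f i ^+ a i) <= (d i * a i).+1)%N.
  by move: H IH; move: (msize _) (msize _) (d i * a i)%N => x y m; lia.
elim: (a i) => [|k IHk]; first by rewrite expr0 msize1.
rewrite exprS; apply: leq_trans (msizeM_leq _ _) _.
by move: (fd i) IHk; move: (msize _) (msize _) => x y; nia.
Qed.

(** For every D, the independent products e_i f^a of weighted degree < D lie in
    the space of polynomials of degree < D + E; comparing dimensions for large
    D bounds the number of indices i. *)
Theorem bezout_bound (f : 'I_n -> P) (g : P) (d : 'I_n -> nat)
    (Z : seq 'rV[K]_n) : (0 < n)%N ->
  (forall i, (0 < d i)%N) -> (forall i, (msize (f i) <= (d i).+1)%N) ->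
  uniq Z -> (forall z, common_zero f g z <-> z \in Z) ->
  (size Z <= \prod_i d i)%N.
Proof.
move=> n0 d0 fd uZ ZP; rewrite leqNgt; apply/negP => ltZ.
pose N := size Z; pose z (j : 'I_N) := Z`_j.
pose e (i : 'I_N) : P := \prod_(j < N | j != i)
  (if [pick k | z i 0 k != z j 0 k] is Some k then 'X_k - (z j 0 k)%:MP else 1).
have e0 i j : i != j -> (e i).@[z j 0] = 0.
  move=> ij; rewrite /e (bigD1 j) 1?eq_sym //= mevalM.
  case: pickP => [k _|zz]; first by rewrite mevalB mevalXU mevalC subrr mul0r.
  case/eqP: ij; apply/val_inj/eqP; rewrite -(nth_uniq 0 _ _ uZ) ?ltn_ord //.
  by apply/eqP/rowP => k; apply/eqP; have /negbFE := zz k.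
have e1 i : (e i).@[z i 0] != 0.
  rewrite (rmorph_prod (meval (z i 0))); apply/prodf_neq0 => j ji.
  case: pickP => [k|_]; last by rewrite rmorph1 oner_eq0.
  by rewrite rmorphB /= mevalXU mevalC subr_eq0.
(* E bounds the degrees of the interpolating polynomials, whatever D is. *)
pose E := \max_i msize (e i).
pose S D := #|{: 'X_{1..n < D}}|.
have count D : (N * #|[pred a : 'X_{1..n < D} | (wdeg d a < D)%N]| <= S (D + E))%N.
  rewrite leqNgt; apply/negP => lt.
  pose B := [pred x : 'I_N * 'X_{1..n < D} | (wdeg d x.2 < D)%N].
  have cardB : #|B| = (N * #|[pred a : 'X_{1..n < D} | (wdeg d a < D)%N]|)%N.
    rewrite -[N in (N * _)%N]card_ord -cardX.
    by apply: eq_card => -[x a]; rewrite !inE.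
  have [|l [[[j a] la] lB lP]] := @lin_dep K _ 'X_{1..n < D + E} B predT
    (fun x m => (e x.1 * mmap1 f x.2)@_m); first by rewrite cardB.
  case/eqP: la.
  pose lam j (a : 'X_{1..n}) := if insub a is Some a' then l (j, a') else 0.
  have lamE j' (a' : 'X_{1..n < D}) : lam j' a' = l (j', a') by rewrite /lam valK.
  rewrite -lamE.
  apply: (powers_independent uncK n0 (f := f) (g := g) (z := z) (e := e) (D := D)) => //.
  - by exists Z => x /ZP.
  - by move=> i; apply/ZP/mem_nth.
  - rewrite pair_big /= -[RHS](_ : \sum_x l x *: (e x.1 * mmap1 f x.2) = 0).
      by apply: eq_bigr => -[x y] _; rewrite lamE.
    apply/mpolyP => m; rewrite mcoeff0 raddf_sum /=.
    have [mD|Dm] := ltnP (mdeg m) (D + E).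
      rewrite -[RHS](lP (BMultinom mD) isT).
      by apply: eq_bigr => x _; rewrite mcoeffZ.
    apply: big1 => x _; rewrite mcoeffZ.
    have [xB|/lB->] := boolP (x \in B); last by rewrite mul0r.
    rewrite memN_msupp_eq0 ?mulr0 //; apply: msize_mdeg_ge.
    apply: leq_trans Dm; apply: leq_trans (msizeM_leq _ _) _.
    have := msize_mmap1 x.2 fd; have : (wdeg d x.2 < D)%N := xB.
    have : (msize (e x.1) <= E)%N.
      exact: (@leq_bigmax _ (fun i => msize (e i)) x.1).
    by move: (msize (e _)) (msize (mmap1 _ _)) => u v; lia.
  - exact: bmdeg.
set delta := (\prod_i d i)%N in ltZ.
have delta0 : (0 < delta)%N by rewrite prodn_gt0.
have step D : (delta.+1 * S D <= delta * S (D + E))%N.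
  apply: (@leq_trans (N * S D)); first by rewrite leq_mul2r ltZ orbT.
  apply: leq_trans (leq_mul (leqnn N) (card_wdeg D d0)) _.
  by rewrite mulnA -/delta mulnC leq_mul2l count orbT.
(* If N > delta, the number of monomials of degree < D would grow by the
   factor 1 + 1/delta whenever D increases by E. *)
have grow j : (delta.+1 ^ j <= delta ^ j * S (j * E).+1)%N.
  elim: j => [|j IH].
    rewrite !expn0 mul1n mul0n; apply/card_gt0P.
    have m0 : (mdeg (0%MM : 'X_{1..n}) < 1)%N by rewrite mdeg0.
    by exists (BMultinom m0).
  rewrite expnS; apply: leq_trans (leq_mul (leqnn _) IH) _.
  rewrite mulnCA expnSr -mulnA leq_mul2l; apply/orP; right.
  by apply: leq_trans (step _) _; rewrite mulSn addSn addnC.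
have [j] := exp_beats_poly E n0 delta0; rewrite ltnNge => /negP; apply.
by apply: leq_trans (grow j) _; rewrite leq_mul2l card_mnm_lt orbT.
Qed.

End BezoutBound.

(** * Uncountability of the complex numbers *)

Section Uncountable.
Local Open Scope classical_set_scope.
Context (R : realType).

Lemma bounded_uniq_finite (T : eqType) (A : set T) k :
  ~ (exists s : seq T, [/\ uniq s, size s = k & forall a, a \in s -> A a]) ->
  exists s : seq T, A `<=` [set` s].
Proof.
elim: k => [|k IH] Nk; first by case: Nk; exists [::].
have [[s [us sk sA]]|] := pselect (exists s : seq T,
  [/\ uniq s, size s = k & forall a, a \in s -> A a]); last exact: IH.
exists s => a Aa /=; apply: contrapT => /negP as_; apply: Nk.
exists (a :: s); split=> [|/=|x]; rewrite ?sk //= ?as_ //.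
by rewrite inE => /orP[/eqP->//|/sA].
Qed.

Lemma complex_infinite_fibers : has_infinite_fibers R[i].
Proof.
move=> D; apply: contrapT => /forallNP ND.
have fin N : countable [set x : R | D (real_complex R x) = N].
  have /existsNP[k Nk] := ND N.
  have [s sP] := @bounded_uniq_finite _ [set a : R[i] | D a = N] _ Nk.
  apply/finite_set_countable/(@sub_finite_set _ _ [set` map (@complex.Re R) s]).
    by move=> x /= /sP xs; apply/mapP; exists (real_complex R x).
  exact: finite_seq.
have : countable `[(0 : R), 1].
  apply: (@sub_countable _ _ _ (\bigcup_N [set x : R | D (real_complex R x) = N])).
    by apply: subset_card_le => x _; exists (D (real_complex R x)).
  by apply: bigcup_countable => //.
move=> /lebesgue_measure.countable_lebesgue_measure0.
rewrite lebesgue_measure.lebesgue_measure_itv /= constructive_ereal.lte_fin ltr01.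
move=> /(congr1 (@constructive_ereal.fine R)) /= /eqP.
by rewrite oppr0 addr0 oner_eq0.
Qed.

End Uncountable.

(** * The polynomial system of tangent directions *)

Section DotProduct.

Lemma dotp_morph (S T : comNzRingType) (phi : {rmorphism S -> T}) n (x y : 'rV[S]_n) :
  phi (dotp x y) = dotp (map_mx phi x) (map_mx phi y).
Proof. by rewrite rmorph_sum; apply: eq_bigr => i _; rewrite rmorphM !mxE. Qed.

Context (S : comNzRingType) (n : nat).
Implicit Types x y z : 'rV[S]_n.

Lemma dotpDr x y z : dotp x (y + z) = dotp x y + dotp x z.
Proof. by rewrite !(dotpC x) dotpDl. Qed.

Lemma dotpZr (k : S) x y : dotp x (k *: y) = k * dotp x y.
Proof. by rewrite !(dotpC x) dotpZl. Qed.

Lemma dotpNl x y : dotp (- x) y = - dotp x y.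
Proof. by rewrite -scaleN1r dotpZl mulN1r. Qed.

Lemma dotpNr x y : dotp x (- y) = - dotp x y.
Proof. by rewrite !(dotpC x) dotpNl. Qed.

Lemma dotp0l y : dotp 0 y = 0.
Proof. by rewrite -(scale0r 0) dotpZl mul0r. Qed.

Lemma dotp0r y : dotp y 0 = 0.
Proof. by rewrite dotpC dotp0l. Qed.

Lemma dotp_mul x m (M : 'M[S]_(m, n)) j : (x *m M^T) 0 j = dotp x (row j M).
Proof. by rewrite mxE; apply: eq_bigr => i _; rewrite !mxE. Qed.

End DotProduct.

Definition dotpE := (dotpDl, dotpDr, dotpZl, dotpZr, dotpNl, dotpNr).

(** Look for l on the moment curve (1, t, t^2, ...): each v <> 0 excludes only
    the roots t of a nonzero polynomial. *)
Lemma nonvanishing_form (F : closedFieldType) n (s : seq 'rV[F]_n) :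
  exists l : 'rV[F]_n, forall v, v \in s -> v != 0 -> dotp v l != 0.
Proof.
pose pol (v : 'rV[F]_n) : {poly F} := \sum_i v 0 i *: 'X^i.
have pol_eval v t : (pol v).[t] = dotp v (\row_i t ^+ i).
  rewrite horner_sum; apply: eq_bigr => i _.
  by rewrite hornerZ hornerXn mxE.
have pol0 v : v != 0 -> pol v != 0.
  move=> /rV0Pn[i vi]; apply: contraNneq vi => /(congr1 (fun p : {poly F} => p`_i)).
  rewrite coef0 coef_sum (bigD1 i) //= coefZ coefXn eqxx mulr1 big1 ?addr0 => [->//|].
  move=> j ji; rewrite coefZ coefXn [_ == _ :> nat]eq_sym.
  by rewrite (inj_eq val_inj) (negPf ji) mulr0.
have /closed_nonrootP[t tP] : \prod_(v <- s | v != 0) pol v != 0.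
  by rewrite prodf_seq_neq0; apply/allP => v _; apply/implyP; apply: pol0.
exists (\row_i t ^+ i) => v vs v0.
move: tP; rewrite rootE horner_prod prodf_seq_neq0 => /allP/(_ v vs).
by rewrite v0 pol_eval.
Qed.

Section Lines.
Local Open Scope classical_set_scope.
Context (R : realType) (n : nat).
Local Notation C := R[i].
Implicit Types p v q z l : 'rV[C]_n.

Lemma cline_shift p v t s : s != 0 -> cline (p + t *: v) (s *: v) = cline p v.
Proof.
move=> s0; apply/seteqP; split=> _ [u _ <-].
  exists (t + u * s) => //.
  by rewrite scalerDl addrA scalerA.
exists ((u - t) / s) => //.
by rewrite scalerA divfK // scalerBl [u *: v - _]addrC addrA addrK.
Qed.

Lemma cline_dir p v p' v' : cline p v = cline p' v' -> exists k, v' = k *: v.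
Proof.
move=> E.
have /= [s _ Ep] : cline p v p' by rewrite E; exists 0; rewrite // scale0r addr0.
have /= [s' _ Ev] : cline p v (p' + v').
  by rewrite E; exists 1; rewrite // scale1r.
exists (s' - s); apply: (addrI p').
by rewrite -Ev -Ep scalerBl addrA addrAC addrK.
Qed.

End Lines.

Section DegreeBounds.
Context (F : fieldType) (n : nat).
Local Notation P := {mpoly F[n]}.

Definition degle m (p : P) := (msize p <= m.+1)%N.

Lemma degleD m p q : degle m p -> degle m q -> degle m (p + q).
Proof.
by rewrite /degle => pm qm; apply: leq_trans (mmeasureD_le _ _ _) _; rewrite geq_max pm.
Qed.

Lemma degleN m p : degle m p -> degle m (- p).
Proof. by rewrite /degle msizeN. Qed.

Lemma degleC m (x : F) : degle m x%:MP.
Proof. by rewrite /degle msizeC; case: eqP. Qed.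

Lemma degleM k m p q : degle k p -> degle m q -> degle (k + m) (p * q).
Proof.
rewrite /degle => pk qm; apply: leq_trans (msizeM_leq _ _) _.
by move: pk qm; move: (msize _) (msize _) => x y; lia.
Qed.

Lemma degle_sum m (I : Type) (r : seq I) (Q : pred I) (E : I -> P) :
  (forall i, Q i -> degle m (E i)) -> degle m (\sum_(i <- r | Q i) E i).
Proof.
move=> Em; elim/big_ind: _ => //; last exact: degleD.
by rewrite /degle msize0.
Qed.

Lemma degleXU m i : (0 < m)%N -> degle m ('X_i : P).
Proof. by rewrite /degle msizeX mdeg1. Qed.

Lemma degle_dotp k m (x y : 'rV[P]_n) :
  (forall i, degle k (x 0 i)) -> (forall i, degle m (y 0 i)) ->
  degle (k + m) (dotp x y).
Proof. by move=> xk ym; apply: degle_sum => i _; apply: degleM. Qed.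

End DegreeBounds.

Section TangentSystem.
Local Open Scope classical_set_scope.
Context (C : numClosedFieldType) (n N : nat) (c : 'I_N -> 'rV[C]_n) (rho : 'I_N -> C).
Context (i0 : 'I_N) (fr : 'I_n -> 'I_N).
Local Notation P := {mpoly C[n]}.

(** The center c i0 plays the role of the origin, and the centers fr j are n of
    the others, assumed to be independent after translation wherever this is
    used. *)
Definition offset (i : 'I_N) : 'rV[C]_n := c i - c i0.
Definition kappa (i : 'I_N) : C :=
  dotp (offset i) (offset i) - rho i + rho i0.
Definition frame : 'M[C]_n := \matrix_j offset (fr j).

Definition quadric (z : 'rV[C]_n) i : C :=
  dotp z z * kappa i - dotp z (offset i) ^+ 2.
(** z^2 times the foot of the perpendicular from c i0 to a tangent with
    direction z, relative to c i0: it is the solution x of the linear equations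
    2 x . offset (fr j) = quadric z (fr j). *)
Definition foot (z : 'rV[C]_n) : 'rV[C]_n :=
  2^-1 *: ((\row_j quadric z (fr j)) *m (invmx frame)^T).

(** The same expressions over the polynomial ring, at the generic vector. *)
Definition varX : 'rV[P]_n := \row_i 'X_i.
Definition const (x : 'rV[C]_n) : 'rV[P]_n := map_mx (@mpolyC n C) x.

Definition quadricP i : P :=
  dotp varX varX * (kappa i)%:MP - dotp varX (const (offset i)) ^+ 2.
Definition footP : 'rV[P]_n :=
  (2^-1)%:MP *: ((\row_j quadricP (fr j)) *m (map_mx (@mpolyC n C) (invmx frame))^T).

Definition cubicP : P := dotp footP varX.
Definition quarticP : P :=
  dotp footP footP - (rho i0)%:MP * (dotp varX varX * dotp varX varX).
Definition linearP l : P := dotp varX (const l) - 1.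

Definition special l : seq (P * nat) :=
  [:: (cubicP, 3%N); (quarticP, 4%N); (linearP l, 1%N)].

Definition others := [pred i | (i != i0) && (i \notin codom fr)].

(** The equations with their degrees: one quadric for every center outside the
    frame, the cubic foot . z = 0, the quartic foot^2 = r_0^2 (z^2)^2 and the
    normalization l . z = 1. *)
Definition system (l : 'rV[C]_n) : seq (P * nat) :=
  [seq (2%:MP * dotp footP (const (offset i)) - quadricP i, 2%N) | i <- enum others]
  ++ special l.

Section Evaluation.
Variable z : 'rV[C]_n.
Local Notation ev := (meval (z 0)).

Lemma eval_dotp (x y : 'rV[P]_n) :
  (dotp x y).@[z 0] = dotp (map_mx ev x) (map_mx ev y).
Proof. exact: (dotp_morph (meval (z 0) : {rmorphism P -> C})). Qed.

Lemma eval_varX : map_mx ev varX = z.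
Proof. by apply/rowP => i; rewrite !mxE /= mevalXU. Qed.

Lemma eval_const x : map_mx ev (const x) = x.
Proof. by apply/rowP => i; rewrite !mxE /= mevalC. Qed.

Lemma eval_quadricP i : (quadricP i).@[z 0] = quadric z i.
Proof.
rewrite /quadricP mevalB mevalM mevalC expr2 mevalM.
by rewrite /quadric !eval_dotp eval_varX eval_const.
Qed.

Lemma eval_footP : map_mx ev footP = foot z.
Proof.
apply/rowP => i; rewrite !mxE mevalM mevalC; congr (_ * _).
rewrite raddf_sum; apply: eq_bigr => j _.
by rewrite /= !mxE mevalM mevalC eval_quadricP.
Qed.

Lemma eval_system l : (forall x, x \in system l -> x.1.@[z 0] = 0) <->
  [/\ forall i, i != i0 -> i \notin codom fr ->
        2 * dotp (foot z) (offset i) = quadric z i,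
      dotp (foot z) z = 0,
      dotp (foot z) (foot z) = rho i0 * (dotp z z) ^+ 2 &
      dotp z l = 1].
Proof.
have E1 i : (2%:MP * dotp footP (const (offset i)) - quadricP i).@[z 0] =
    2 * dotp (foot z) (offset i) - quadric z i.
  rewrite mevalB eval_quadricP mevalM mevalC.
  by rewrite eval_dotp eval_const eval_footP.
have E2 : cubicP.@[z 0] = dotp (foot z) z.
  by rewrite /cubicP eval_dotp eval_varX eval_footP.
have E3 : quarticP.@[z 0] =
    dotp (foot z) (foot z) - rho i0 * (dotp z z) ^+ 2.
  rewrite /quarticP mevalB mevalM mevalC mevalM !eval_dotp eval_varX eval_footP.
  by rewrite expr2.
have E4 : (linearP l).@[z 0] = dotp z l - 1.
  by rewrite /linearP mevalB meval1 eval_dotp eval_varX eval_const.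
split=> [Z0|[F1 F2 F3 F4] x].
  have inS p k : (p, k) \in special l -> p.@[z 0] = 0.
    by move=> pS; apply: (Z0 (p, k)); rewrite mem_cat pS orbT.
  split=> [i ii0 ic|||].
  - apply/eqP; rewrite -subr_eq0 -E1; apply/eqP.
    apply: (Z0 (_, 2%N)); rewrite mem_cat; apply/orP; left.
    by apply/mapP; exists i; rewrite // mem_enum inE ii0.
  - by rewrite -E2; apply: (inS _ 3%N); rewrite !inE eqxx.
  - by apply/eqP; rewrite -subr_eq0 -E3; apply/eqP/(inS _ 4%N); rewrite !inE eqxx !orbT.
  by apply/eqP; rewrite -subr_eq0 -E4; apply/eqP/(inS _ 1%N); rewrite !inE eqxx !orbT.
rewrite mem_cat => /orP[xm|].
  have [i iO ->] := mapP xm; move: iO; rewrite mem_enum => /andP[ii0 ic].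
  by rewrite E1 F1 // subrr.
rewrite !inE => /or3P[] /eqP->; rewrite ?E2 ?E3 ?E4 //.
  by rewrite F3 subrr.
by rewrite F4 subrr.
Qed.

End Evaluation.

Lemma degle_system l x : x \in system l -> degle x.2 x.1 /\ (0 < x.2)%N.
Proof.
have dX i : degle 1 (varX 0 i) by rewrite mxE; apply: degleXU.
have dC y i : degle 0 (const y 0 i) by rewrite mxE; apply: degleC.
have dXX : degle 2 (dotp varX varX) by apply: (@degle_dotp _ _ 1 1).
have dQ i : degle 2 (quadricP i).
  apply: degleD; first by apply: (@degleM _ _ 2 0) => //; apply: degleC.
  by apply/degleN/(@degleM _ _ 1 1); apply: (@degle_dotp _ _ 1 0).
have dF i : degle 2 (footP 0 i).
  rewrite !mxE; apply: (@degleM _ _ 0 2); first exact: degleC.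
  apply: degle_sum => j _; rewrite !mxE.
  by apply: (@degleM _ _ 2 0) => //; apply: degleC.
rewrite mem_cat => /orP[xm|] /=.
  have [i _ ->] := mapP xm; split=> //; apply: degleD; last exact: degleN.
  apply: (@degleM _ _ 0 2); first exact: degleC.
  by apply: (@degle_dotp _ _ 2 0).
rewrite !inE => /or3P[] /eqP->; split=> //=.
- by apply: (@degle_dotp _ _ 2 1).
- apply: degleD; first by apply: (@degle_dotp _ _ 2 2).
  apply/degleN/(@degleM _ _ 0 4); first exact: degleC.
  by apply: (@degleM _ _ 2 2).
apply: degleD; first by apply: (@degle_dotp _ _ 1 0).
by apply: degleN; rewrite -mpolyC1; apply: degleC.
Qed.

End TangentSystem.

(** * Tangent lines and solutions of the system *)

Section TangentCorrespondence.
Context (C : numClosedFieldType) (n N : nat) (c : 'I_N -> 'rV[C]_n) (rho : 'I_N -> C).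
Context (i0 : 'I_N) (fr : 'I_n -> 'I_N).
Hypothesis frame_unit : frame c i0 fr \in unitmx.
Local Notation off := (offset c i0).
Local Notation quad := (quadric c rho i0).
Local Notation footz := (foot c rho i0 fr).
Implicit Types (p v q z l : 'rV[C]_n) (i : 'I_N).

Definition tangent_to p v i :=
  dotp v (p - c i) ^+ 2 = dotp v v * (dotp (p - c i) (p - c i) - rho i).

Definition solves l z := forall x, x \in system c rho i0 fr l -> x.1.@[z 0] = 0.

Lemma foot_frame z j : 2 * dotp (footz z) (off (fr j)) = quad z (fr j).
Proof.
have -> : off (fr j) = row j (frame c i0 fr) by apply/rowP => k; rewrite !mxE.
rewrite -dotp_mul /foot -scalemxAl -mulmxA -trmx_mul mulmxV // trmx1 mulmx1.
by rewrite !mxE mulrA divff ?mul1r // pnatr_eq0.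
Qed.

Lemma frame_inj v w : (forall j, dotp v (off (fr j)) = dotp w (off (fr j))) -> v = w.
Proof.
move=> vw; have uT : (frame c i0 fr)^T \in unitmx by rewrite unitmx_tr.
apply: (can_inj (mulmxK uT)); apply/rowP => j.
rewrite !dotp_mul; have -> : row j (frame c i0 fr) = off (fr j); last exact: vw.
by apply/rowP => k; rewrite !mxE.
Qed.

Lemma off0 : off i0 = 0. Proof. exact: subrr. Qed.

Lemma quad0 z : quad z i0 = 0.
Proof. by rewrite /quadric /kappa off0 !dotp0r sub0r addNr mulr0 expr0n subr0. Qed.

(** If v^2 = 0, tangency says that v is orthogonal to every p - c i, hence to
    all differences of centers, and those span. *)
Lemma tangent_nonisotropic p v : v != 0 -> (forall i, tangent_to p v i) -> dotp v v != 0.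
Proof.
move=> v0 vt; apply: contraNneq v0 => vv; apply/eqP.
have vc i : dotp v (p - c i) = 0.
  by apply/eqP; rewrite -sqrf_eq0 vt vv mul0r.
apply: frame_inj => j; rewrite dotp0l /offset.
have -> : c (fr j) - c i0 = (p - c i0) - (p - c (fr j)).
  by rewrite opprB [RHS]addrC addrA subrK.
by rewrite dotpDr dotpNr !vc subrr.
Qed.

(** The terms of tangency quadratic in q and z.q are eliminated by q.z = 0 and
    q^2 = r_0^2; what remains is linear in q. *)
Lemma tangent_quad z q i : dotp q z = 0 -> dotp q q = rho i0 ->
  tangent_to (q + c i0) z i <-> 2 * dotp z z * dotp q (off i) = quad z i.
Proof.
move=> qz qq; rewrite /tangent_to /quadric /kappa.
have -> : q + c i0 - c i = q - off i by rewrite /offset opprB addrA.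
set w := off i; clearbody w.
rewrite !dotpE (dotpC z q) qz qq (dotpC w q).
set A := dotp z z; set B := dotp z w; set D := dotp q w; set E := dotp w w.
split=> [H|H].
  have -> : 2 * A * D =
      A * (E - rho i + rho i0) - A * (rho i0 - D + (- D - - E) - rho i) by ring.
  by rewrite -H; ring.
have -> : A * (rho i0 - D + (- D - - E) - rho i) =
    A * (E - rho i + rho i0) - 2 * A * D by ring.
by rewrite H; ring.
Qed.

Lemma tangent_footz z q : dotp z z != 0 -> dotp q z = 0 ->
  tangent_to (q + c i0) z i0 -> dotp q q = rho i0.
Proof.
move=> zz qz; rewrite /tangent_to addrK dotpC qz expr0n /= => /esym/eqP.
by rewrite mulf_eq0 (negPf zz) subr_eq0 => /eqP.
Qed.

Lemma tangent_solves l z q : dotp z z != 0 -> dotp q z = 0 -> dotp z l = 1 ->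
  (forall i, tangent_to (q + c i0) z i) -> solves l z /\ footz z = dotp z z *: q.
Proof.
move=> zz qz zl tg; have qq := tangent_footz zz qz (tg i0).
have qi i : 2 * dotp z z * dotp q (off i) = quad z i.
  exact/(tangent_quad _ qz qq).
have nz2 : 2 != 0 :> C by rewrite pnatr_eq0.
have Ef : footz z = dotp z z *: q.
  apply: frame_inj => j; apply: (mulfI nz2).
  by rewrite foot_frame -qi dotpZl mulrA.
split=> //; apply/eval_system; rewrite Ef; split=> //.
- by move=> i _ _; rewrite dotpZl mulrA qi.
- by rewrite dotpZl qz mulr0.
by rewrite dotpZl dotpZr qq; ring.
Qed.

Lemma solves_tangent l z : dotp z z != 0 -> solves l z ->
  forall i, tangent_to ((dotp z z)^-1 *: footz z + c i0) z i.
Proof.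
move=> zz /eval_system[F1 F2 F3 _] i.
have qz : dotp ((dotp z z)^-1 *: footz z) z = 0 by rewrite dotpZl F2 mulr0.
have qq : dotp ((dotp z z)^-1 *: footz z) ((dotp z z)^-1 *: footz z) = rho i0.
  by rewrite dotpZl dotpZr F3; field.
apply/(tangent_quad _ qz qq).
rewrite dotpZl mulrA mulfK //.
have [->|ii0] := eqVneq i i0; first by rewrite off0 dotp0r mulr0 quad0.
have [/codomP[j ->]|ic] := boolP (i \in codom fr); first exact: foot_frame.
exact: F1.
Qed.

Lemma size_system l : injective fr -> i0 \notin codom fr ->
  size (system c rho i0 fr l) = (N - n.+1 + 3)%N.
Proof.
move=> injfr i0fr; rewrite size_cat size_map -cardE /=; congr (_ + _)%N.
have := cardC [predU1 i0 & codom fr].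
rewrite cardU1 i0fr card_codom // !card_ord add1n => EN.
have -> : (N - n.+1 = #|[predC [predU1 i0 & codom fr]]|)%N.
  by apply/eqP; rewrite -(eqn_add2l n.+1) EN subnKC // -EN leq_addr.
by apply: eq_card => i; rewrite !inE negb_or.
Qed.

Lemma prod_system l : injective fr -> i0 \notin codom fr ->
  (\prod_(x <- system c rho i0 fr l) x.2 = 2 ^ (N - n.+1) * 12)%N.
Proof.
move=> injfr i0fr; have := size_system l injfr i0fr.
rewrite size_cat size_map -cardE => /eqP; rewrite eqn_add2r => /eqP szO.
rewrite big_cat big_map big_enum /= prod_nat_const szO.
by rewrite !big_cons big_nil.
Qed.

Lemma frame_base_notin : i0 \notin codom fr.
Proof.
apply/negP => /codomP[j Ej].
have : delta_mx 0 j = 0 :> 'rV[C]_n.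
  apply: (can_inj (mulmxK frame_unit)); rewrite -rowE mul0mx.
  by apply/rowP => k; rewrite !mxE -Ej subrr.
move=> /rowP/(_ j); rewrite !mxE !eqxx => /eqP.
by rewrite oner_eq0.
Qed.

End TangentCorrespondence.

(** * The upper bound *)

Section UpperBound.
Local Open Scope classical_set_scope.
Local Open Scope card_scope.
Context (R : realType) (n : nat).
Local Notation C := R[i].

Lemma affine_frame N (c : 'I_N -> 'rV[R]_n) (i0 : 'I_N) : affinely_spans c ->
  exists fr : 'I_n -> 'I_N,
    injective fr /\ frame (fun i => complexify (c i)) i0 fr \in unitmx.
Proof.
move=> spanc; pose D : 'M[R]_(N, n) := \matrix_i (c i - c i0).
have fullD : row_full D.
  apply/row_fullP.
  have /choice[b bP] : forall k : 'I_n, exists a : 'rV[R]_N, a *m D = delta_mx 0 k.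
    move=> k; have [a [a1 aE]] := spanc (delta_mx 0 k + c i0).
    exists (\row_i a i); apply: (addIr (c i0)); rewrite aE.
    rewrite -[in LHS](scale1r (c i0)) -a1 scaler_suml mulmx_sum_row -big_split /=.
    by apply: eq_bigr => i _; rewrite mxE rowK -scalerDr subrK.
  exists (\matrix_k b k); apply/row_matrixP => k.
  by rewrite row_mul rowK bP row1.
exists (fullrankfun fullD); split; first exact: fullrankfun_inj.
have -> : frame (fun i => complexify (c i)) i0 (fullrankfun fullD) =
    map_mx (real_complex R) (rowsub (fullrankfun fullD) D).
  by apply/matrixP => j k; rewrite !mxE rmorphB.
by rewrite map_unitmx fullrowsub_unit.
Qed.

Lemma card_seq_le (T : eqType) (s : seq T) : [set` s] #<= `I_(size s).
Proof.
case: s => [|x s]; first by rewrite set_nil; exact: card_ge0.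
have -> : [set` x :: s] = nth x (x :: s) @` `I_(size (x :: s)).
  apply/seteqP; split=> [y /= ys|_ [k /= ks <-]]; last exact: mem_nth.
  exists (index y (x :: s)); last exact: nth_index.
  by move: ys; rewrite -index_mem.
exact: card_image_le.
Qed.

(** Sending a solution z to the line with direction z through its foot is a
    bijection from the nonisotropic solutions of the system to the common
    tangents.  Injectivity carries the finiteness over to the solutions, and
    surjectivity carries the Bezout bound back to the lines. *)
Lemma common_tangents_bound (c : 'I_(2 * n - 2) -> 'rV[R]_n)
    (r : 'I_(2 * n - 2) -> R) : (3 <= n)%N -> affinely_spans c ->
  finite_set (common_tangents c r) ->
  common_tangents c r #<= `I_(3 * 2 ^ (n - 1)).
Proof.
move=> n3 spanc finT; set T := common_tangents c r in finT *.
have N0 : (0 < 2 * n - 2)%N by lia.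
pose i0 : 'I_(2 * n - 2) := Ordinal N0.
have [fr [injfr frU]] := affine_frame i0 spanc.
pose cc i := complexify (c i); pose rho i : C := (r i)%:C%C ^+ 2.
have i0fr := frame_base_notin frU.
have /choice[dir dirP] : forall L, exists v : 'rV[C]_n, T L ->
    v != 0 /\ exists p, L = cline p v /\ forall i, tangent_to cc rho p v i.
  move=> L; have [[p [v [v0 LE tg]]]|NT] := pselect (T L); last by exists 0.
  by exists v => _; split=> //; exists p; split=> // i; apply: tg.
have /finite_seqP[s sE] := finite_image dir finT.
have [l lP] := nonvanishing_form s.
pose sys := system cc rho i0 fr l.
have szsys : size sys = n by rewrite /sys size_system //; lia.
pose f (j : 'I_n) := (nth (0, 0%N) sys j).1.
pose d (j : 'I_n) := (nth (0, 0%N) sys j).2.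
pose g : {mpoly C[n]} := dotp (varX C n) (varX C n).
have czP z : common_zero f g z <-> solves cc rho i0 fr l z /\ dotp z z != 0.
  rewrite /common_zero /g eval_dotp eval_varX; split=> -[fz zz]; split=> //.
    move=> x xs; have xn : (index x sys < n)%N.
      by apply: (@leq_trans (size sys)); rewrite ?index_mem // szsys.
    by have := fz (Ordinal xn); rewrite /f /= nth_index.
  by move=> j; apply: fz; rewrite mem_nth // szsys.
pose L z := cline ((dotp z z)^-1 *: foot cc rho i0 fr z + cc i0) z.
have LT z : common_zero f g z -> T (L z).
  move=> /czP[sz zz]; exists ((dotp z z)^-1 *: foot cc rho i0 fr z + cc i0), z.
  split=> //; first by apply: contraNneq zz => ->; rewrite dotp0l.
  exact: (solves_tangent frU zz sz).
have Linj : {in [set z | common_zero f g z] &, injective L}.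
  move=> z z'; rewrite !inE => /czP[/eval_system[_ _ _ zl] _].
  move=> /czP[/eval_system[_ _ _ zl'] _] /cline_dir[k kE].
  by move: zl'; rewrite kE dotpZl zl mulr1 => ->; rewrite scale1r.
have Lsurj : T `<=` L @` [set z | common_zero f g z].
  move=> M TM; have [v0 [p [ME tg]]] := dirP _ TM; set v := dir M in v0 ME tg.
  have vl : dotp v l != 0.
    apply: lP => //; have : (dir @` T) v by exists M.
    by rewrite sE.
  pose k := (dotp v l)^-1; pose z := k *: v.
  have k0 : k != 0 by rewrite invr_eq0.
  have vv := tangent_nonisotropic frU v0 tg.
  have zz : dotp z z != 0 by rewrite dotpZl dotpZr !mulf_neq0.
  pose t := - (dotp (p - cc i0) v / dotp v v).
  pose q := p - cc i0 + t *: v.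
  have qz : dotp q z = 0.
    by rewrite /q /z dotpZr dotpDl dotpZl /t mulNr divfK // subrr mulr0.
  have pq : q + cc i0 = p + t *: v by rewrite /q addrAC subrK.
  have ME' : M = cline (q + cc i0) z by rewrite pq cline_shift.
  have tg' i : tangent_to cc rho (q + cc i0) z i.
    by apply: (@tangent_cline R n p v _ _ (c i) (r i)); rewrite -?ME' -?ME //; apply: tg.
  have zl : dotp z l = 1 by rewrite dotpZl mulVf.
  have [sz Ez] := tangent_solves frU zz qz zl tg'.
  exists z; first by apply/czP.
  by rewrite /L Ez scalerA mulVf // scale1r.
have finZ : finite_set [set z | common_zero f g z].
  rewrite -(eq_finite_set (inj_card_eq Linj)).
  by apply: sub_finite_set finT => _ [z zP <-]; apply: LT.
have [Z0 Z0E] := (finite_seqP _).1 finZ.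
pose Z := undup Z0.
have ZP z : common_zero f g z <-> z \in Z.
  by rewrite mem_undup; have : [set z | common_zero f g z] z <-> [set` Z0] z
    by rewrite Z0E.
have szZ : (size Z <= 3 * 2 ^ (n - 1))%N.
  have sysP (j : 'I_n) : nth (0, 0%N) sys j \in sys by rewrite mem_nth // szsys.
  have -> : (3 * 2 ^ (n - 1) = \prod_j d j)%N.
    have -> : (\prod_j d j = \prod_(x <- sys) x.2)%N.
      by rewrite (big_nth (0, 0%N)) szsys big_mkord.
    rewrite prod_system //.
    have -> : (n - 1 = (2 * n - 2 - n.+1) + 2)%N by lia.
    by rewrite expnD; lia.
  refine (@bezout_bound C n (@complex_infinite_fibers R) f g d Z _ _ _ _ ZP).
  - by lia.
  - by move=> j; have [] := degle_system (sysP j).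
  - by move=> j; have [] := degle_system (sysP j).
  exact: undup_uniq.
apply: (@card_le_trans _ _ _ (L @` [set` Z])).
  apply: subset_card_le => M /Lsurj[z zP <-]; exists z => //=.
  exact/ZP.
apply: card_le_trans (card_image_le _ _) _.
by apply: card_le_trans (card_seq_le _) _; rewrite card_le_II.
Qed.

End UpperBound.

(** * The configuration of unit spheres *)

(** The cyclic symmetry of the first three coordinates is addition in 'I_3. *)
Section TetrahedronSums.

Lemma ord3_cycle (k x : 'I_3) : [|| x == k, x == k + 1 | x == k + 2].
Proof. by case: k x => [[|[|[|]]] //= ?] [[|[|[|]]] //= ?]. Qed.

Lemma ord3_neq (k : 'I_3) : [/\ k + 1 != k, k + 2 != k & k + 2 != k + 1].
Proof. by case: k => [[|[|[|]]] //= ?]. Qed.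

Lemma sum3 (V : nmodType) (F : 'I_3 -> V) (k : 'I_3) :
  \sum_(x < 3) F x = F k + F (k + 1) + F (k + 2).
Proof.
have [n1 n2 n3] := ord3_neq k.
rewrite (bigD1 k) //= (bigD1 (k + 1)) //= (bigD1 (k + 2)) /= ?n2 // big1 ?addr0.
  by rewrite addrA.
move=> x /andP[/andP[xk xk1] xk2].
by case/or3P: (ord3_cycle k x) => xE;
  [case: (negP xk)|case: (negP xk1)|case: (negP xk2)].
Qed.

End TetrahedronSums.

Section Configuration.
Context (R : realType) (m : nat).
Local Notation n := (3 + m)%N.
Implicit Types (p v : 'rV[R]_n) (k l : 'I_3) (j : 'I_m).

Local Notation nu := (n%:R : R).

(** The scale makes the value of (v_1 v_2)^2 + (v_1 v_3)^2 + (v_2 v_3)^2 equal to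
    2 for unit spheres: together with v_1^2 + v_2^2 + v_3^2 = 3 and
    v_1 v_2 v_3 = 0 this gives {v_1^2, v_2^2, v_3^2} = {0, 1, 2}. *)
Definition scale : R := nu / Num.sqrt (3 * nu ^+ 2 - 3 * nu + 2).
Local Notation s := scale.

(** The factor sqrt 3 makes the points of the axes as far from the origin as
    the vertices of the tetrahedron. *)
Definition arm : R := Num.sqrt 3 * s.

Lemma nuE : nu = m%:R + 3 :> R. Proof. by rewrite natrD addrC. Qed.

Lemma nu_ge3 : 3 <= nu :> R. Proof. by rewrite ler_nat. Qed.

Lemma scale_gt0 : 0 < s.
Proof.
rewrite /scale; move: nu_ge3; move: (nu) => x x3.
rewrite divr_gt0 //; first by lra.
by rewrite sqrtr_gt0; nra.
Qed.

Lemma scale2 : s ^+ 2 * (3 * nu ^+ 2 - 3 * nu + 2) = nu ^+ 2.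
Proof.
rewrite /scale; move: nu_ge3; move: (nu) => x x3.
have D0 : 0 < 3 * x ^+ 2 - 3 * x + 2 by nra.
by rewrite expr_div_n sqr_sqrtr ?ltW // divfK // gt_eqF.
Qed.

Lemma arm2 : arm ^+ 2 = 3 * s ^+ 2.
Proof. by rewrite exprMn sqr_sqrtr // ler0n. Qed.

Lemma arm_neq0 : arm != 0.
Proof. by rewrite mulf_neq0 ?gt_eqF ?scale_gt0 // sqrtr_gt0 ltr0n. Qed.

(** The sign patterns have product +1: alternate vertices of a cube. *)
Definition tetra (i : nat) : 'rV[R]_n :=
  row_mx (\row_(k < 3) (if (i == 0%N) || (i == k.+1) then s else - s)) 0.
Definition spike (j : nat) (b : bool) : 'rV[R]_n :=
  row_mx 0 (\row_(x < m) (if x == j :> nat then (-1) ^+ b * arm else 0)).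

(** From index 4 on, the indices 4 + 2 j and 5 + 2 j are the two points of the
    j-th axis. *)
Definition center (i : nat) : 'rV[R]_n :=
  if (i < 4)%N then tetra i else spike (i - 4)./2 (odd i).

Definition lo k : 'I_n := lshift m k.
Definition hi j : 'I_n := rshift 3 j.

Lemma dotp_split p v k : dotp p v =
  p 0 (lo k) * v 0 (lo k) + p 0 (lo (k + 1)) * v 0 (lo (k + 1)) +
  p 0 (lo (k + 2)) * v 0 (lo (k + 2)) + \sum_j p 0 (hi j) * v 0 (hi j).
Proof. by rewrite /dotp big_split_ord -(sum3 (fun x => p 0 (lo x) * v 0 (lo x))). Qed.

Lemma tetra_hi i j : tetra i 0 (hi j) = 0.
Proof. by rewrite row_mxEr mxE. Qed.

Lemma dotp_tetra0 p k : dotp p (tetra 0) =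
  s * (p 0 (lo k) + p 0 (lo (k + 1)) + p 0 (lo (k + 2))).
Proof.
rewrite (dotp_split _ _ k) !row_mxEl !mxE big1 ?addr0 => [|j _].
  by rewrite /=; ring.
by rewrite tetra_hi mulr0.
Qed.

Lemma dotp_tetra p k : dotp p (tetra k.+1) =
  s * (p 0 (lo k) - p 0 (lo (k + 1)) - p 0 (lo (k + 2))).
Proof.
have [n1 n2 _] := ord3_neq k.
rewrite (dotp_split _ _ k) !row_mxEl !mxE big1 ?addr0 => [|j _]; last first.
  by rewrite tetra_hi mulr0.
rewrite /= !eqSS eqxx.
have -> : (k == k + 1 :> nat) = false by apply/negbTE; rewrite eq_sym.
have -> : (k == k + 2 :> nat) = false by apply/negbTE; rewrite eq_sym.
by ring.
Qed.

Lemma dotp_spike p j b : dotp p (spike j b) = (-1) ^+ b * arm * p 0 (hi j).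
Proof.
rewrite (dotp_split _ _ 0) !row_mxEl !mxE !mulr0 !add0r (bigD1 j) //=.
rewrite row_mxEr mxE eqxx big1 ?addr0 1?mulrC // => x xj.
by rewrite row_mxEr mxE (_ : (x == j :> nat) = false) ?mulr0 //; apply/negbTE.
Qed.

Lemma centerP (Q : 'rV[R]_n -> Prop) :
  (forall i : 'I_(2 * n - 2), Q (center i)) <->
  [/\ Q (tetra 0), forall k, Q (tetra k.+1) & forall j b, Q (spike j b)].
Proof.
split=> [Qc|[Q0 Qt Qs] i].
  split=> [|k|j b].
  - have i0 : (0 < 2 * n - 2)%N by lia.
    exact: (Qc (Ordinal i0)).
  - have ik : (k.+1 < 2 * n - 2)%N by have := ltn_ord k; lia.
    have := Qc (Ordinal ik); rewrite /center /=.
    by rewrite ltnS ltn_ord.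
  have ij : (4 + j.*2 + b < 2 * n - 2)%N by have := ltn_ord j; lia.
  suff <- : center (4 + j.*2 + b) = spike j b by exact: (Qc (Ordinal ij)).
  rewrite /center.
  have -> : (4 + j.*2 + b < 4)%N = false by lia.
  have -> : ((4 + j.*2 + b - 4)./2 = j)%N by lia.
  by rewrite !oddD odd_double /= oddb.
rewrite /center; case: ifP => i4.
  move: i4; case: (i : nat) => [//|k] k4.
  by have := Qt (Ordinal (k4 : (k < 3)%N)).
have jm : ((i - 4)./2 < m)%N by have := ltn_ord i; lia.
by have := Qs (Ordinal jm) (odd i).
Qed.

Lemma tetra_lo i k :
  tetra i 0 (lo k) = if (i == 0%N) || (i == k.+1) then s else - s.
Proof. by rewrite row_mxEl mxE. Qed.

Lemma tetra_inj i i' : (i < 4)%N -> (i' < 4)%N -> tetra i = tetra i' -> i = i'.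
Proof.
move=> i4 i4' E.
have sN : (s == - s) = false.
  by apply/negbTE; rewrite -addr_eq0 -mulr2n mulrn_eq0 /= gt_eqF // scale_gt0.
have Ek k : ((i == 0%N) || (i == k.+1)) = ((i' == 0%N) || (i' == k.+1)).
  have := tetra_lo i k; rewrite E tetra_lo; move/eqP.
  by do 2![case: ifP => _] => //; rewrite ?sN // eq_sym sN.
by move: i4 i4' (Ek 0) (Ek 1) (Ek 2); do 5?[case: i E Ek => [|i] E Ek //];
  do 5?[case: i' E Ek => [|i'] E Ek //].
Qed.

Lemma spike_inj j j' b b' : spike j b = spike j' b' -> j = j' /\ b = b'.
Proof.
move=> /rowP/(_ (hi j)); rewrite !row_mxEr !mxE eqxx.
case: eqP => [/ord_inj jj'|_ /eqP]; last first.
  by rewrite mulf_eq0 signr_eq0 (negPf arm_neq0).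
by move=> /(mulIf arm_neq0)/signr_inj.
Qed.

Lemma center_inj : injective (fun i : 'I_(2 * n - 2) => center i).
Proof.
have mixed i (j0 : nat) b : tetra i <> spike j0 b.
  move=> /rowP/(_ (lo 0)); rewrite tetra_lo row_mxEl mxE.
  by case: ifP => _ /eqP; rewrite ?oppr_eq0 gt_eqF // scale_gt0.
move=> i i'; rewrite /center; have i_lt := ltn_ord i; have i_lt' := ltn_ord i'.
case: ltnP => i4; case: ltnP => i4' E; apply: val_inj => /=.
- exact: tetra_inj E.
- by case: (mixed _ _ _ E).
- by case: (mixed _ _ _ (esym E)).
have jm : ((i - 4)./2 < m)%N by lia.
have jm' : ((i' - 4)./2 < m)%N by lia.
have [[]] := @spike_inj (Ordinal jm) (Ordinal jm') _ _ E.
lia.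
Qed.

Definition unit_tangent p v c :=
  dotp v (p - c) ^+ 2 = dotp v v * (dotp (p - c) (p - c) - 1).

Lemma unit_tangentE p v c : dotp p v = 0 -> unit_tangent p v c <->
  dotp v c ^+ 2 = dotp v v * (dotp p p - 2 * dotp p c + dotp c c - 1).
Proof.
move=> pv; rewrite /unit_tangent !dotpE (dotpC v p) pv (dotpC c p) sub0r sqrrN.
by split=> ->; congr (_ * _); ring.
Qed.

Definition footpoint v : 'rV[R]_n :=
  row_mx (\row_k (- (s / nu) * (v 0 (lo (k + 1)) * v 0 (lo (k + 2))))) 0.

(** The real directions v of the common tangents, scaled to v^2 = n. *)
Record tangent_direction v : Prop := TangentDirection {
  direction_hi_sqr : forall j, v 0 (hi j) ^+ 2 = 1;
  direction_lo_prod : v 0 (lo 0) * v 0 (lo 1) * v 0 (lo 2) = 0;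
  direction_lo_sum : v 0 (lo 0) ^+ 2 + v 0 (lo 1) ^+ 2 + v 0 (lo 2) ^+ 2 = 3;
  direction_lo_esym2 : (v 0 (lo 0) * v 0 (lo 1)) ^+ 2 + (v 0 (lo 0) * v 0 (lo 2)) ^+ 2 +
    (v 0 (lo 1) * v 0 (lo 2)) ^+ 2 = 2 }.

Lemma ord3E : (0 + 1 = 1 :> 'I_3) * (0 + 2 = 2 :> 'I_3) * (1 + 1 = 2 :> 'I_3) *
  (1 + 2 = 0 :> 'I_3) * (2 + 1 = 0 :> 'I_3) * (2 + 2 = 1 :> 'I_3).
Proof. by do ![split]; apply: val_inj. Qed.

Lemma tetra_norm i : (i < 4)%N -> dotp (tetra i) (tetra i) = 3 * s ^+ 2.
Proof.
case: i => [_|k k3].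
  by rewrite (dotp_tetra0 _ 0) !row_mxEl !mxE /=; ring.
rewrite (dotp_tetra _ (Ordinal (k3 : (k < 3)%N))) !row_mxEl !mxE /= !eqSS eqxx.
by case: k k3 => [|[|[|]]] //= _; ring.
Qed.

Lemma spike_norm j b : dotp (spike j b) (spike j b) = arm ^+ 2.
Proof.
rewrite dotp_spike row_mxEr mxE eqxx mulrACA -expr2 -signr_odd.
by rewrite -expr2 sqrr_sign mul1r.
Qed.

(** The spikes give p_j = 0 and 3 v_j^2 = W, where W is the sum of the first
    three squares; then v^2 = n forces W = 3.  Adding the conditions of two
    vertices of the tetrahedron and subtracting those of the other two isolates
    one of the first coordinates of p; substituted into p.v = 0 and into the
    value of p^2, these give the last two equations on v. *)
Lemma tangents_direction p v : dotp v v = nu -> dotp p v = 0 ->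
  (forall i : 'I_(2 * n - 2), unit_tangent p v (center i)) ->
  tangent_direction v /\ p = footpoint v.
Proof.
move=> vv pv /centerP[T0 Tt Ts].
have s0 := scale_gt0; have nu3 := nu_ge3.
have phi j : p 0 (hi j) = 0.
  have := (unit_tangentE _ pv).1 (Ts j false).
  have := (unit_tangentE _ pv).1 (Ts j true).
  rewrite !spike_norm !dotp_spike vv expr0 expr1 !exprMn sqrrN !expr1n.
  set A := dotp p p; set P := p 0 _ => -> E.
  move: arm_neq0 E nu3; move: (arm) (nu) => a y a0 E y3.
  have : y * (4 * a * P) = 0 by move: E; lra.
  move/eqP; rewrite !mulf_eq0 (negPf a0) pnatr_eq0 /= ?orbF => /orP[y0|/eqP //].
  by move: y3; rewrite (eqP y0); lra.
have hE j : 3 * s ^+ 2 * v 0 (hi j) ^+ 2 = nu * (dotp p p + 3 * s ^+ 2 - 1).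
  have := (unit_tangentE _ pv).1 (Ts j false).
  rewrite !spike_norm !dotp_spike phi vv expr0 mul1r mulr0 mulr0 subr0 exprMn.
  by rewrite arm2.
have := (unit_tangentE _ pv).1 T0.
have := (unit_tangentE _ pv).1 (Tt 0).
have := (unit_tangentE _ pv).1 (Tt 1).
have := (unit_tangentE _ pv).1 (Tt 2).
rewrite !tetra_norm // !dotp_tetra (dotp_tetra0 p 0) (dotp_tetra0 v 0) !ord3E vv.
have := pv; have := vv; have := erefl (dotp p p).
rewrite {2}(dotp_split p p 0) (dotp_split p v 0) (dotp_split v v 0) !ord3E.
rewrite [X in _ = _ + X]big1 => [|j _]; last by rewrite phi mul0r.
rewrite [X in _ + X = 0]big1 => [|j _]; last by rewrite phi mul0r.
set Y := \sum_j _; set pi := dotp p p in hE *.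
set x0 := v 0 (lo 0); set x1 := v 0 (lo 1); set x2 := v 0 (lo 2).
set q0 := p 0 (lo 0); set q1 := p 0 (lo 1); set q2 := p 0 (lo 2).
rewrite !addr0 => piE vvE pvE H2 H1 H0 H.
have sneq : s != 0 by rewrite gt_eqF.
have Q0 : nu * q0 = - s * (x1 * x2).
  by apply: (mulfI sneq); move: H2 H1 H0 H; lra.
have Q1 : nu * q1 = - s * (x2 * x0).
  by apply: (mulfI sneq); move: H2 H1 H0 H; lra.
have Q2 : nu * q2 = - s * (x0 * x1).
  by apply: (mulfI sneq); move: H2 H1 H0 H; lra.
have s2neq : s ^+ 2 != 0 by rewrite expf_neq0.
have WE : s ^+ 2 * (x0 ^+ 2 + x1 ^+ 2 + x2 ^+ 2) = nu * (pi + 3 * s ^+ 2 - 1).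
  by move: H2 H1 H0 H; lra.
have hW j : 3 * v 0 (hi j) ^+ 2 = x0 ^+ 2 + x1 ^+ 2 + x2 ^+ 2.
  by apply: (mulfI s2neq); rewrite WE -(hE j); ring.
have nuneq : nu != 0 by rewrite gt_eqF // (lt_le_trans _ nu3) // ltr0n.
have W3 : x0 ^+ 2 + x1 ^+ 2 + x2 ^+ 2 = 3.
  have YE : 3 * Y = m%:R * (x0 ^+ 2 + x1 ^+ 2 + x2 ^+ 2).
    rewrite mulr_sumr (eq_bigr (fun=> x0 ^+ 2 + x1 ^+ 2 + x2 ^+ 2)).
      by rewrite sumr_const card_ord mulr_natl.
    by move=> j _; rewrite -expr2 hW.
  apply: (mulfI nuneq); move: YE vvE; rewrite nuE.
  move: (m%:R : R) Y => M Y YE vvE.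
  have -> : (M + 3) * 3 = 3 * (x0 * x0 + x1 * x1 + x2 * x2 + Y) by rewrite vvE; ring.
  by rewrite [RHS]mulrDr YE; ring.
have pi2 : nu ^+ 2 * pi = 2 * s ^+ 2.
  have := scale2; have E : nu * (pi + 3 * s ^+ 2 - 1) = 3 * s ^+ 2.
    by rewrite -WE W3 mulrC.
  move: E; move: (nu) (s) => y t E st.
  have -> : y ^+ 2 * pi = y * (y * (pi + 3 * t ^+ 2 - 1)) - 3 * t ^+ 2 * y ^+ 2 + y ^+ 2.
    by ring.
  by rewrite E; move: st; lra.
split.
  split=> [j|||] //; rewrite -?/x0 -?/x1 -?/x2.
  - have three0 : 3 != 0 :> R by rewrite pnatr_eq0.
    by apply: (mulfI three0); rewrite hW W3 mulr1.
  - have c0 : - 3 * s != 0 by rewrite mulf_neq0 // oppr_eq0 pnatr_eq0.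
    apply: (mulfI c0); rewrite mulr0.
    rewrite -[RHS](mulr0 nu) -pvE.
    have -> : nu * (q0 * x0 + q1 * x1 + q2 * x2) =
        nu * q0 * x0 + nu * q1 * x1 + nu * q2 * x2 by ring.
    by rewrite Q0 Q1 Q2; ring.
  apply: (mulfI s2neq); rewrite mulrC [RHS]mulrC -pi2 piE.
  have -> : nu ^+ 2 * (q0 * q0 + q1 * q1 + q2 * q2) =
     (nu * q0) ^+ 2 + (nu * q1) ^+ 2 + (nu * q2) ^+ 2 by ring.
  by rewrite Q0 Q1 Q2; ring.
have pE (q x y : R) : nu * q = - s * (x * y) -> q = - (s / nu) * (x * y).
  move: nuneq; move: (nu) => z z0 E; apply: (mulfI z0); rewrite E.
  by field.
apply/rowP => x; case: (split_ordP x) => [k|j] ->; last by rewrite row_mxEr mxE phi.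
rewrite row_mxEl mxE; apply: pE.
have := ord3_cycle 0 k; rewrite !add0r.
by case/or3P => /eqP->; rewrite !ord3E.
Qed.

Lemma tangent_direction_norm v : tangent_direction v -> dotp v v = nu.
Proof.
case=> vhi _ W _; rewrite (dotp_split _ _ 0) !ord3E (eq_bigr (fun=> 1)).
  by rewrite sumr_const card_ord nuE -W; ring.
by move=> j _; rewrite -expr2.
Qed.

Lemma tangent_direction_foot v : tangent_direction v -> dotp (footpoint v) v = 0.
Proof.
case=> _ V0 _ _; rewrite (dotp_split _ _ 0) big1 ?addr0 => [|j _].
  rewrite !row_mxEl !mxE !ord3E -[RHS](mulr0 (- 3 * (s / nu))) -V0.
  by ring.
by rewrite row_mxEr mxE mul0r.
Qed.

Lemma tangent_direction_tangents v : tangent_direction v ->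
  forall i : 'I_(2 * n - 2), unit_tangent (footpoint v) v (center i).
Proof.
move=> gv; have fv := tangent_direction_foot gv; have nv := tangent_direction_norm gv.
have st := scale2.
have nuneq : nu != 0 by rewrite pnatr_eq0.
have ffE : nu ^+ 2 * dotp (footpoint v) (footpoint v) = 2 * s ^+ 2.
  rewrite (dotp_split _ _ 0) big1 ?addr0 => [|j _]; last by rewrite row_mxEr mxE mul0r.
  rewrite !row_mxEl !mxE !ord3E -(direction_lo_esym2 gv).
  by move: nuneq; move: (nu) => z z0; field.
have key : nu * (dotp (footpoint v) (footpoint v) + 3 * s ^+ 2 - 1) = 3 * s ^+ 2.
  apply: (mulfI nuneq); move: ffE st; move: (dotp _ _) (nu) (s) => D y t ffE st.
  have -> : y * (y * (D + 3 * t ^+ 2 - 1)) = y ^+ 2 * D + 3 * t ^+ 2 * y ^+ 2 - y ^+ 2.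
    by ring.
  by rewrite ffE; move: st; lra.
have split_key (w e : R) : w ^+ 2 = 3 * s ^+ 2 - 2 * nu * e ->
    w ^+ 2 = nu * (dotp (footpoint v) (footpoint v) - 2 * e + 3 * s ^+ 2 - 1).
  by move=> ->; move: key; move: (nu) (s) (dotp _ _) => y t D; lra.
have W := direction_lo_sum gv.
apply/centerP; split=> [|k|j b]; apply/(unit_tangentE _ fv); rewrite nv.
- rewrite tetra_norm //; apply: split_key.
  rewrite !(dotp_tetra0 _ 0) !row_mxEl !mxE !ord3E -W.
  by move: nuneq; move: (nu) => z z0; field.
- rewrite tetra_norm; last by have := ltn_ord k; lia.
  apply: split_key.
  have -> : 3 = v 0 (lo k) ^+ 2 + v 0 (lo (k + 1)) ^+ 2 + v 0 (lo (k + 2)) ^+ 2 :> R.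
    rewrite -W; have := ord3_cycle 0 k; rewrite !add0r.
    by case/or3P => /eqP->; rewrite !ord3E; ring.
  rewrite !dotp_tetra !row_mxEl !mxE.
  have := ord3_cycle 0 k; rewrite !add0r.
  by move: nuneq; move: (nu) => z z0 /or3P[] /eqP->; rewrite !ord3E; field.
rewrite spike_norm arm2 !dotp_spike.
rewrite row_mxEr mxE !mulr0 subr0 key exprMn exprMn sqrr_sign mul1r arm2.
by rewrite (direction_hi_sqr gv) mulr1.
Qed.

End Configuration.

(** * Parametrization of the tangents *)

Section Parametrization.
Context (R : realType) (m : nat).
Local Notation n := (3 + m)%N.
Implicit Types (p v : 'rV[R]_n) (k l : 'I_3) (j : 'I_m).

(** The parameters are the coordinate that vanishes, which of the other two
    first coordinates has square 2, and the signs of the remaining n - 2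
    coordinates.  The coordinate of square 2 is taken positive, which chooses
    one of the two opposite directions. *)
Definition param := ('I_3 * bool * {ffun 'I_m.+1 -> bool})%type.
Implicit Types (x y : param).

Definition long (k : 'I_3) (b : bool) : 'I_3 := if b then k + 1 else k + 2.
Definition short (k : 'I_3) (b : bool) : 'I_3 := if b then k + 2 else k + 1.

Lemma ord3_other k b : [/\ long k b != k, short k b != k & short k b != long k b].
Proof. by case: k b => [[|[|[|]]] //= ?] []. Qed.

Lemma ord3_cover k b l : [|| l == k, l == long k b | l == short k b].
Proof. by case: k b l => [[|[|[|]]] //= ?] [] [[|[|[|]]] //= ?]. Qed.

Definition direction x : 'rV[R]_n :=
  row_mx (\row_k (if k == x.1.1 then 0 else if k == long x.1.1 x.1.2 then Num.sqrt 2
                  else (-1) ^+ x.2 ord0))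
         (\row_j (-1) ^+ x.2 (lift ord0 j)).

Lemma direction_lo x : [/\ direction x 0 (lo m x.1.1) = 0,
  direction x 0 (lo m (long x.1.1 x.1.2)) = Num.sqrt 2 &
  direction x 0 (lo m (short x.1.1 x.1.2)) = (-1) ^+ x.2 ord0].
Proof.
have [n1 n2 n3] := ord3_other x.1.1 x.1.2.
by rewrite !row_mxEl !mxE eqxx (negPf n1) eqxx (negPf n2) (negPf n3).
Qed.

Lemma direction_hi x j : direction x 0 (hi j) = (-1) ^+ x.2 (lift ord0 j).
Proof. by rewrite row_mxEr mxE. Qed.

Lemma sqr_sqrt2 : Num.sqrt 2 ^+ 2 = 2 :> R.
Proof. by rewrite sqr_sqrtr // ler0n. Qed.

Lemma sqrt2_gt0 : 0 < Num.sqrt 2 :> R.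
Proof. by rewrite sqrtr_gt0 ltr0n. Qed.

Lemma direction_tangent x : tangent_direction (direction x).
Proof.
have [D0 D1 D2] := direction_lo x; have S2 := sqr_sqrt2.
split=> [j|||]; first by rewrite direction_hi sqrr_sign.
all: move: D0 D1 D2; case: x.1 => k b /=; rewrite /long /short.
all: have := ord3_cycle 0 k; rewrite !add0r; case: b => /or3P[] /eqP->.
all: rewrite !ord3E => -> -> ->; rewrite ?(mulr0, mul0r) // ?exprMn ?expr0n /=.
all: by rewrite S2 sqrr_sign; ring.
Qed.

Lemma footpoint_sign (b : bool) v : footpoint ((-1) ^+ b *: v) = footpoint v.
Proof.
congr row_mx; apply/rowP => k; rewrite !mxE mulrACA -expr2 sqrr_sign mul1r.
by [].
Qed.

Lemma tangent_direction_lo v : tangent_direction v -> exists k b,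
  [/\ v 0 (lo m k) = 0, v 0 (lo m (long k b)) ^+ 2 = 2 &
      v 0 (lo m (short k b)) ^+ 2 = 1].
Proof.
case=> _ V0 V1 V2.
have pair (a c : R) : a ^+ 2 + c ^+ 2 = 3 -> (a * c) ^+ 2 = 2 ->
    (a ^+ 2 = 2 /\ c ^+ 2 = 1) \/ (c ^+ 2 = 2 /\ a ^+ 2 = 1).
  move=> S P; have : (a ^+ 2 - 2) * (c ^+ 2 - 2) = 0.
    have -> : (a ^+ 2 - 2) * (c ^+ 2 - 2) = (a * c) ^+ 2 - 2 * (a ^+ 2 + c ^+ 2) + 4.
      by ring.
    by rewrite S P; ring.
  by move=> /eqP; rewrite mulf_eq0 !subr_eq0 => /orP[] /eqP E; [left|right];
    split=> //; move: S; rewrite E; lra.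
move/eqP: V0; rewrite !mulf_eq0 => /orP[/orP[]|] /eqP Z; rewrite Z in V1 V2.
- have [||[? ?]|[? ?]] := pair (v 0 (lo m 1)) (v 0 (lo m 2)).
  + by rewrite -V1; ring.
  + by rewrite -V2; ring.
  + by exists 0, true; rewrite /long /short !add0r.
  + by exists 0, false; rewrite /long /short !add0r.
- have [||[? ?]|[? ?]] := pair (v 0 (lo m 2)) (v 0 (lo m 0)).
  + by rewrite -V1; ring.
  + by rewrite -V2; ring.
  + by exists 1, true; rewrite /long /short !ord3E.
  + by exists 1, false; rewrite /long /short !ord3E.
- have [||[? ?]|[? ?]] := pair (v 0 (lo m 0)) (v 0 (lo m 1)).
  + by rewrite -V1; ring.
  + by rewrite -V2; ring.
  + by exists 2, true; rewrite /long /short !ord3E.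
  + by exists 2, false; rewrite /long /short !ord3E.
Qed.

Lemma sqr_eq1_sign (a : R) : a ^+ 2 = 1 -> a = (-1) ^+ (a < 0)%R.
Proof.
move/eqP; rewrite sqrf_eq1 => /orP[] /eqP->; first by rewrite ltr10.
by rewrite ltrN10.
Qed.

Lemma tangent_directionP v : tangent_direction v ->
  exists x (b : bool), v = (-1) ^+ b *: direction x.
Proof.
move=> gv; have [k [b [vk vl vs]]] := tangent_direction_lo gv.
pose c := v 0 (lo m (long k b)) < 0; pose w := (-1) ^+ c *: v.
have sgnc (t : R) : ((-1) ^+ c * t) ^+ 2 = t ^+ 2 by rewrite exprMn sqrr_sign mul1r.
pose e : {ffun 'I_m.+1 -> bool} := [ffun i : 'I_m.+1 =>
  if unlift ord0 i is Some j then w 0 (hi j) < 0 else w 0 (lo m (short k b)) < 0].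
exists (k, b, e), c; suff -> : direction (k, b, e) = w.
  by rewrite scalerA -expr2 sqrr_sign scale1r.
have [D0 D1 D2] := direction_lo (k, b, e).
apply/rowP => i; case: (split_ordP i) => [l|j] ->; last first.
  rewrite -/(hi j) direction_hi /= ffunE liftK -sqr_eq1_sign //.
  by rewrite mxE sgnc (direction_hi_sqr gv).
case/or3P: (ord3_cover k b l) => /eqP->; rewrite -/(lo m _).
- by rewrite D0 mxE vk mulr0.
- rewrite D1 mxE; apply/eqP; rewrite -(eqrXn2 (n := 2)) ?sqrtr_ge0 //.
    by rewrite sgnc vl sqr_sqrt2.
  rewrite /c; case: ltrP => ?; rewrite ?expr1 ?expr0 ?mul1r ?mulN1r //.
  by rewrite oppr_ge0 ltW.
rewrite D2 /= ffunE unlift_none -sqr_eq1_sign // mxE sgnc //.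
Qed.

Lemma direction_inj x y t : direction y = t *: direction x -> y = x.
Proof.
move=> E.
have t1 : t ^+ 2 = 1.
  have nu0 : (n%:R : R) != 0 by rewrite pnatr_eq0.
  apply: (mulIf nu0); rewrite mul1r.
  rewrite -[in RHS](tangent_direction_norm (direction_tangent y)) E.
  by rewrite dotpZl dotpZr mulrA -expr2 (tangent_direction_norm (direction_tangent x)).
have t0 : t != 0 by rewrite -sqrf_eq0 t1 oner_eq0.
have Ei i : direction y 0 i = t * direction x 0 i by rewrite E mxE.
have sq i : direction y 0 i ^+ 2 = direction x 0 i ^+ 2 by rewrite Ei exprMn t1 mul1r.
have [X0 X1 X2] := direction_lo x; have [Y0 Y1 Y2] := direction_lo y.
have n2 : 2 != 0 :> R by rewrite pnatr_eq0.
have n21 : 2 != 1 :> R by rewrite (eqr_nat _ 2 1).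
have kE : y.1.1 = x.1.1.
  case/or3P: (ord3_cover x.1.1 x.1.2 y.1.1) => /eqP // k'.
    have := sq (lo m y.1.1); rewrite Y0 k' X1 sqr_sqrt2 expr0n.
    by move=> /esym/eqP; rewrite (negPf n2).
  have := sq (lo m y.1.1); rewrite Y0 k' X2 sqrr_sign expr0n.
  by move=> /esym/eqP; rewrite oner_eq0.
have lE : long y.1.1 y.1.2 = long x.1.1 x.1.2.
  case/or3P: (ord3_cover x.1.1 x.1.2 (long y.1.1 y.1.2)) => /eqP // l'.
    have := sq (lo m (long y.1.1 y.1.2)); rewrite Y1 l' X0 sqr_sqrt2.
    by rewrite expr0n => /eqP; rewrite (negPf n2).
  have := sq (lo m (long y.1.1 y.1.2)); rewrite Y1 l' X2 sqr_sqrt2.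
  by rewrite sqrr_sign => /eqP; rewrite (negPf n21).
have bE : y.1.2 = x.1.2.
  move: lE; rewrite kE /long; have [_ _ n3] := ord3_neq x.1.1.
  by case: y.1.2; case: x.1.2 => // /eqP; rewrite ?(negPf n3) // eq_sym (negPf n3).
have tE : t = 1.
  have := Ei (lo m (long y.1.1 y.1.2)); rewrite Y1 lE X1 => /eqP.
  rewrite -subr_eq0 -{1}[Num.sqrt 2]mul1r -mulrBl mulf_eq0.
  by rewrite [Num.sqrt 2 == 0]gt_eqF ?sqrt2_gt0 // orbF subr_eq0 => /eqP.
move: Ei; rewrite tE => Ei.
have eE : y.2 = x.2.
  apply/ffunP => i; case: (unliftP ord0 i) => [j|] ->.
    by have := Ei (hi j); rewrite !direction_hi mul1r => /signr_inj.
  have := Ei (lo m (short y.1.1 y.1.2)); rewrite Y2 kE bE X2 mul1r.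
  by move=> /signr_inj.
move: kE bE eE; case: x y {E X0 X1 X2 Y0 Y1 Y2 Ei sq lE} => [[k b] e] [[k' b'] e'].
by move=> /= -> -> ->.
Qed.

Lemma card_param : #|{: param}| = (3 * 2 ^ (n - 1))%N.
Proof.
rewrite !card_prod card_ord card_bool card_ffun card_bool card_ord.
by rewrite (_ : n - 1 = m.+2)%N ?expnS ?mulnA //; lia.
Qed.

End Parametrization.

(** * Counting the real tangents *)

Section RealTangents.
Local Open Scope classical_set_scope.
Local Open Scope card_scope.

Lemma tangent_morph (F E : fieldType) (phi : {rmorphism F -> E}) n
    (p v c : 'rV[F]_n) (r : F) :
  let q := map_mx phi p - map_mx phi c in
  dotp (map_mx phi v) q ^+ 2 =
    dotp (map_mx phi v) (map_mx phi v) * (dotp q q - phi r ^+ 2) <->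
  dotp v (p - c) ^+ 2 = dotp v v * (dotp (p - c) (p - c) - r ^+ 2).
Proof.
rewrite /= -map_mxB -!dotp_morph -!rmorphXn -rmorphB -rmorphM.
by split=> [/fmorph_inj|->].
Qed.

Context (R : realType) (m : nat).
Local Notation n := (3 + m)%N.
Local Notation C := R[i].

Lemma tangent_unit (p v c : 'rV[R]_n) :
  tangent (complexify p) (complexify v) c 1 <-> unit_tangent p v c.
Proof.
have := tangent_morph (real_complex R) p v c 1.
by rewrite expr1n.
Qed.

Lemma complexifyD (p v : 'rV[R]_n) : complexify (p + v) = complexify p + complexify v.
Proof. exact: map_mxD. Qed.

Lemma complexifyE (v : 'rV[R]_n) i : complexify v 0 i = real_complex R (v 0 i).
Proof. by rewrite mxE. Qed.

Lemma complexifyZ t (v : 'rV[R]_n) :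
  complexify (t *: v) = real_complex R t *: complexify v.
Proof. exact: map_mxZ. Qed.

Definition param_line (x : param m) : set 'rV[C]_n :=
  cline (complexify (footpoint (direction R x))) (complexify (direction R x)).

Lemma dotp_gt0 (v : 'rV[R]_n) : v != 0 -> 0 < dotp v v.
Proof.
move=> /rV0Pn[i vi]; rewrite /dotp (bigD1 i) //=; apply: ltr_pwDl.
  by rewrite -expr2 exprn_even_gt0.
by apply: sumr_ge0 => j _; rewrite -expr2 sqr_ge0.
Qed.

Lemma direction_neq0 (x : param m) : direction R x != 0.
Proof.
apply/eqP => E; have := tangent_direction_norm (direction_tangent R x); rewrite E dotp0l.
by move/esym/eqP; rewrite pnatr_eq0.
Qed.

Lemma complexify_neq0 (v : 'rV[R]_n) : v != 0 -> complexify v != 0.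
Proof.
move=> /rV0Pn[i vi]; apply/rV0Pn; exists i.
by rewrite mxE fmorph_eq0.
Qed.

Lemma param_line_inj : injective param_line.
Proof.
move=> x y /cline_dir[t E]; have [_ X1 _] := direction_lo R x.
set i := lo m _ in X1.
pose u := direction R y 0 i / Num.sqrt 2.
have Ei k : complexify (direction R y) 0 k = t * complexify (direction R x) 0 k.
  by rewrite E mxE.
have tE : t = real_complex R u.
  have := Ei i; rewrite !complexifyE X1 => Exy.
  have s0 : real_complex R (Num.sqrt 2) != 0 by rewrite fmorph_eq0 gt_eqF ?sqrt2_gt0.
  apply: (mulIf s0); rewrite -Exy /u -rmorphM divfK //.
  by rewrite gt_eqF ?sqrt2_gt0.
apply/esym/(@direction_inj R m x y u)/rowP => j.
have := Ei j; rewrite !complexifyE tE -rmorphM.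
by move=> /fmorph_inj->; rewrite [in RHS]mxE.
Qed.

Local Notation centers := (fun i : 'I_(2 * n - 2) => center R m i).

Lemma real_common_tangentsE :
  real_common_tangents centers (fun=> 1) = range param_line.
Proof.
apply/seteqP; split=> [L [[p' [v' [v0' LE' tg']]] [p0 [v0 [v0n LE]]]]|_ [x _ <-]].
  have vv0 := dotp_gt0 v0n.
  pose t := Num.sqrt (n%:R / dotp v0 v0); pose u := - (dotp p0 v0 / dotp v0 v0).
  have t2 : t ^+ 2 = n%:R / dotp v0 v0.
    by rewrite sqr_sqrtr // divr_ge0 ?ler0n // ltW.
  have t0 : t != 0.
    by rewrite -sqrf_eq0 t2 mulf_neq0 ?invr_eq0 ?pnatr_eq0 // gt_eqF.
  pose v := t *: v0; pose p := p0 + u *: v0.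
  have vv : dotp v v = n%:R.
    by rewrite dotpZl dotpZr mulrA -expr2 t2 divfK // gt_eqF.
  have pv : dotp p v = 0.
    by rewrite dotpZr dotpDl dotpZl mulNr divfK ?subrr ?mulr0 // gt_eqF.
  have LE1 : L = cline (complexify p) (complexify v).
    by rewrite LE complexifyD !complexifyZ cline_shift // fmorph_eq0.
  have tg i : unit_tangent p v (centers i).
    apply/tangent_unit; apply: (@tangent_cline _ _ p' v' _ _ _ 1) => //.
    by rewrite -LE' LE1.
  have [gv pE] := tangents_direction vv pv tg.
  have [x [b vE]] := tangent_directionP gv.
  exists x => //; rewrite LE1 /param_line pE vE footpoint_sign complexifyZ.
  rewrite -[complexify (footpoint _) in RHS]addr0.
  rewrite -[X in _ + X](scale0r (complexify (direction R x))).
  by rewrite cline_shift // fmorph_eq0 signr_eq0.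
split; last first.
  exists (footpoint (direction R x)), (direction R x).
  by split=> //; exact: direction_neq0.
exists (complexify (footpoint (direction R x))), (complexify (direction R x)).
split=> //; first exact/complexify_neq0/direction_neq0.
by move=> i; apply/tangent_unit/tangent_direction_tangents/direction_tangent.
Qed.

Lemma card_range_fin (T : finType) (U : Type) (f : T -> U) :
  injective f -> range f #= `I_#|T|.
Proof.
move=> injf.
case E : #|T| => [|k].
  have -> : range f = set0.
    by apply/seteqP; split=> // y [x _ _]; case: (fintype0 x E).
  by rewrite II0.
have [x0 _] : exists x, x \in T by apply/card_gt0P; rewrite E.
pose h i := f (nth x0 (enum T) i).
have -> : range f = h @` `I_k.+1.
  apply/seteqP; split=> [_ [x _ <-]|_ [i _ <-]]; last by exists (nth x0 (enum T) i).
  exists (index x (enum T)); last by rewrite /h nth_index // mem_enum.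
  by rewrite /= -E cardE index_mem mem_enum.
apply: inj_card_eq => i j; rewrite !inE /= -E cardE => ik jk /injf/eqP.
by rewrite nth_uniq ?enum_uniq // => /eqP.
Qed.

Lemma unit_configuration :
  exists c : 'I_(2 * n - 2) -> 'rV[R]_n, injective c /\
    real_common_tangents c (fun=> 1) #= `I_(3 * 2 ^ (n - 1)).
Proof.
exists centers; split; first exact: center_inj.
rewrite real_common_tangentsE -(card_param m).
exact: card_range_fin param_line_inj.
Qed.

End RealTangents.

Local Open Scope classical_set_scope.
Local Open Scope card_scope.

Theorem theorem2 (R : realType) (n : nat) (hn : (3 <= n)%N) :
  (forall (c : 'I_(2 * n - 2) -> 'rV[R]_n) (r : 'I_(2 * n - 2) -> R),
     affinely_spans c -> (forall i, 0 < r i) ->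
     finite_set (common_tangents c r) ->
     common_tangents c r #<= `I_(3 * 2 ^ (n - 1))) /\
  ((exists (c : 'I_(2 * n - 2) -> 'rV[R]_n) (r : 'I_(2 * n - 2) -> R),
     [/\ forall i, 0 < r i,
         injective (fun i => (c i, r i)) &
         real_common_tangents c r #= `I_(3 * 2 ^ (n - 1))]) /\
   (exists c : 'I_(2 * n - 2) -> 'rV[R]_n,
     injective c /\
     real_common_tangents c (fun=> 1) #= `I_(3 * 2 ^ (n - 1)))).
Proof.
split=> [c r spanc _|]; first exact: common_tangents_bound.
have [m nE] : exists m, n = (3 + m)%N by exists (n - 3)%N; rewrite subnKC.
rewrite {hn}nE; have [c [injc cardc]] := unit_configuration R m.
split; last by exists c.
by exists c, (fun=> 1); split=> // i i' [/injc].
Qed.
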